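(* Let $K$ be a field of characteristic zero. For every integer $D\ge1$, $$\dim M_4(D)=\binom D4,\qquad \dim M_5(D)=D\binom D4,\qquad \dim M_6(D)=2\binom{D+1}2\binom D4,$$ $$\dim M_7(D)=2D\binom{D+1}2\binom D4-\dim L(\mathbf{3,2,1^2};D).$$
   Context: $K$ is a field of characteristic zero. $T(D)$ is the free non-unital associative $K$-algebra on $x_1,\dots,x_D$, with the anti-involution $\sigma$ fixing each $x_i$. $CJ(D)=T(D)^\sigma$ (Cohn's Jordan algebra), with Jordan product $x\circ y=\frac12(xy+yx)$. $SJ(D)\subset CJ(D)$ is the Jordan subalgebra generated by $x_1,\dots,x_D$. The space of missing tetrads is $M(D)=CJ(D)/SJ(D)$, equivalently the cokernel of the natural map from the free Jordan algebra on $x_1,\dots,x_D$ to $CJ(D)$; $M_n(D)$ is its component of degree $n$ in the generators. For a Young diagram $\mathbf{Y}$ with rows $m_1\ge m_2\ge\cdots$, $L(\mathbf{Y};D)$ is the simple polynomial $GL(D)$-module of highest weight $\mathbf{Y}$ if $\mathbf{Y}$ has at most $D$ rows, and $0$ otherwise. $\mathbf{(3,2,1^2)}$ is the diagram with rows of lengths $3,2,1,1$. *)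

(* Defs.v *)
From HB Require Import structures.
From mathcomp Require Import all_boot all_order all_algebra.
From mathcomp Require Import finmap monalg.
From mathcomp Require mpoly.

Set Implicit Arguments.
Unset Strict Implicit.
Unset Printing Implicit Defensive.

Import GRing.Theory.
Local Open Scope ring_scope.

(* The unital free associative algebra K<x_1, ..., x_D>; the non-unital T(D)  *)
(* is its augmentation ideal, see in_T.                                       *)
Notation free_alg K D := {malg K[{fmonom 'I_D}]}.

Section FreeAlgebra.
Context {K : fieldType} {D : nat}.
Implicit Types (f g : free_alg K D) (w : {fmonom 'I_D}).

Definition gen (i : 'I_D) : free_alg K D := << fmu i >>.

Definition in_T f : Prop := f@_mone = 0.

Definition homog (n : nat) f : Prop := forall w, w \in msupp f -> fdeg w = n.

Definition rev_word w : {fmonom 'I_D} := FMonom (rev w).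

(* sigma_gen, sigma_lin, sigmaM and sigmaK below show that sigma is the       *)
(* anti-involution fixing the generators.                                     *)
Definition sigma f : free_alg K D :=
  \sum_(w <- msupp f) << f@_w *g rev_word w >>.

Definition jprod f g : free_alg K D := 2^-1 *: (f * g + g * f).

Definition CJ f : Prop := in_T f /\ sigma f = f.

Inductive SJ : free_alg K D -> Prop :=
| SJ_gen i : SJ (gen i)
| SJ_0 : SJ 0
| SJ_lin (a : K) f g : SJ f -> SJ g -> SJ (a *: f + g)
| SJ_mul f g : SJ f -> SJ g -> SJ (jprod f g).

Lemma rev_wordK : involutive rev_word.
Proof. by move=> w; apply/eqP; rewrite fmP /= revK. Qed.

Lemma mcoeff_sigma f w : (sigma f)@_w = f@_(rev_word w).
Proof.
rewrite /sigma raddf_sum /=.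
have E v : (rev_word v == w) = (v == rev_word w).
  by rewrite -(inj_eq (can_inj rev_wordK)) rev_wordK.
under eq_bigr => v _ do rewrite mcoeffU E.
case: (msuppP f (rev_word w)) => [w_f|w_f].
- rewrite (big_rem _ w_f) /= eqxx mulr1n big_seq big1 ?addr0 // => v.
  by rewrite mem_rem_uniq ?fset_uniq // inE => /andP[/negbTE-> _]; rewrite mulr0n.
- rewrite big_seq big1 // => v v_f.
  by case: eqP v_f w_f => [-> ->|_ _ _] //; rewrite mulr0n.
Qed.

Lemma sigmaK : involutive sigma.
Proof. by move=> f; apply/malgP => w; rewrite !mcoeff_sigma rev_wordK. Qed.

Lemma sigma_lin (a : K) f g : sigma (a *: f + g) = a *: sigma f + sigma g.
Proof.
apply/malgP => w; rewrite mcoeff_sigma !(mcoeffD, mcoeffZ).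
by rewrite !mcoeff_sigma.
Qed.

Lemma sigmaU (a : K) w : sigma << a *g w >> = << a *g rev_word w >>.
Proof.
apply/malgP => v; rewrite mcoeff_sigma !mcoeffU; congr (_ *+ nat_of_bool _).
by rewrite -(inj_eq (can_inj rev_wordK)) rev_wordK.
Qed.

Lemma sigma_gen i : sigma (gen i) = gen i.
Proof.
rewrite /gen sigmaU; congr << _ >>; apply/eqP.
by rewrite fmP /= fmU.
Qed.

Lemma sigmaM f g : sigma (f * g) = sigma g * sigma f.
Proof.
have sigma_sum (r : seq {fmonom 'I_D}) (F : {fmonom 'I_D} -> free_alg K D) :
    sigma (\sum_(t <- r) F t) = \sum_(t <- r) sigma (F t).
  apply/malgP => w; rewrite mcoeff_sigma !(raddf_sum (mcoeff _)) /=.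
  by apply: eq_bigr => t _; rewrite mcoeff_sigma.
rewrite [f * g]malgME sigma_sum.
under eq_bigr => v _ do rewrite sigma_sum.
rewrite exchange_big [sigma g]/sigma big_distrl /=; apply: eq_bigr => w _.
rewrite [sigma f]/sigma big_distrr; apply: eq_bigr => v _ /=.
have -> : << g@_w *g rev_word w >> * << f@_v *g rev_word v >>
    = << g@_w * f@_v *g mmul (rev_word w) (rev_word v) >> by exact: fgmulUU.
rewrite sigmaU [g@_w * _]mulrC; congr << _ *g _ >>.
by apply/eqP; rewrite fmP fmM /= fmM rev_cat.
Qed.

End FreeAlgebra.

(* dim_quot U W d: the image of the subspace U in the quotient by the         *)
(* subspace W has dimension d, i.e. some d elements of U form a basis of it.  *)
Definition dim_quot (K : fieldType) (V : lmodType K) (U W : V -> Prop)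
    (d : nat) : Prop :=
  exists e : 'I_d -> V,
    (forall i, U (e i)) /\
    (forall u, U u -> exists! c : 'rV[K]_d, W (u - \sum_i c 0 i *: e i)).

(* M_n(D) is the image in M(D) = CJ(D) / SJ(D) of the degree n part of CJ(D). *)
Definition dim_missing_tetrads (K : fieldType) (D n d : nat) : Prop :=
  dim_quot (fun f : free_alg K D => CJ f /\ homog n f) SJ d.

Section GLModule.
Context {K : fieldType} {D : nat} {L : vectType K}.
Implicit Type rho : 'M[K]_D -> 'End(L).

(* GL(D) is unitmx; the values of rho at singular matrices are irrelevant.    *)
Definition GL_rep rho : Prop :=
  rho 1%:M = \1%VF /\
  {in unitmx &, forall g h, rho (g *m h) = (rho g \o rho h)%VF}.

Definition polynomial_rep rho : Prop :=
  forall (phi : 'Hom(L, K^o)) (v : L),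
  exists p : mpoly.mpoly (D * D) K,
  {in unitmx, forall g, phi (rho g v) = mpoly.meval (fun k => mxvec g 0 k) p}.

Definition simple_rep rho : Prop :=
  {:L}%VS != 0%VS /\
  forall U : {vspace L},
    {in unitmx, forall g, (rho g @: U <= U)%VS} -> U = 0%VS \/ U = {:L}%VS.

(* Existence of a highest weight vector: an eigenvector of the upper          *)
(* triangular Borel subgroup with character t |-> \prod_i t_i ^+ Y_i.         *)
Definition has_highest_weight rho (Y : seq nat) : Prop :=
  exists2 v : L, v != 0 &
  {in unitmx, forall b, is_trig_mx b^T ->
    rho b v = (\prod_(i < D) b i i ^+ nth 0%N Y i) *: v}.

End GLModule.

(* dim_simple_GL K D Y d: d is the dimension of L(Y; D). The diagram Y is the *)
(* nonincreasing sequence of its (positive) row lengths.                      *)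
Definition dim_simple_GL (K : fieldType) (D : nat) (Y : seq nat) (d : nat) :
    Prop :=
  if (size Y <= D)%N then
    exists (L : vectType K) (rho : 'M[K]_D -> 'End(L)),
      [/\ GL_rep rho, polynomial_rep rho, simple_rep rho,
          has_highest_weight rho Y & \dim {:L} = d]
  else d = 0%N.

(* Main.v *)
From Stdlib Require Import ZArith.
Require Import Defs.
From HB Require Import structures.
From mathcomp Require Import all_boot all_order all_algebra.
From mathcomp Require Import finmap monalg.
From mathcomp Require mpoly.
From mathcomp Require Import fingroup perm ssrZ zify.

(* Write {w} for the sum of a word w and its reversal. Modulo SJ, 12 {abcd} is *)
(* the alternating sum T(a, b, c, d) of all rearrangements of abcd, and all    *)
(* {w} of degree n = 4, ..., 7 reduce to combinations of the elements          *)
(* O_1 ... O_k T(a, b, c, d), where each O_i is one of the operators           *)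
(* L_x : f |-> xf + fx and U_xy : f |-> xfy + yfx at generators x and y. This  *)
(* yields an integral element q_n of the group ring of S_n, acting on words of *)
(* length n by permutation of places, such that q_n w = N {w} modulo SJ for a  *)
(* positive integer N. By the Jordan identity SJ is spanned by the words in    *)
(* the L_x and U_xy applied to generators, so that finitely many formal        *)
(* computations show that q_n kills SJ. Hence q_n / 2N is an idempotent of     *)
(* rank dim M_n, and its trace is a combination of powers D ^ c, where c is    *)
(* the number of cycles of a permutation.                                      *)
(*   L(3,2,1,1; D) is realised as the image of a Young symmetrizer Y in the    *)
(* 7th tensor power of K ^ D. As Y ^ 2 = 144 Y, its dimension is again a       *)
(* trace. By polarization a subspace stable under GL(D) is also stable under   *)
(* the averages over S_7 of the matrix units, and these bring any nonzero      *)
(* vector to the highest weight vector and conversely.                         *)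

Set Implicit Arguments.
Unset Strict Implicit.
Unset Printing Implicit Defensive.

Import GRing.Theory.
Local Open Scope ring_scope.

(** * Formal linear combinations of words *)

(** Let P = q_n / 2N act on the span of the words of length n. Three facts make its image a copy of
    M_n(D): {w} / 2 - Pw lies in SJ ([proj_rel]), P sends every word into CJ ([CJ_tofree_proj]), and
    P vanishes on SJ ([projmx_kill]). By the first, u - Pu lies in SJ for every u in CJ of degree n,
    since such a u is a combination of the {w} / 2 ([CJ_proj]). Applying P to the first fact and
    using that P does not distinguish w from its reversal gives PP = P ([proj_idem]). A basis of the
    image of P is therefore a basis of M_n(D) ([dim_quot_proj]).

    The vanishing on SJ is a finite question: SJ is spanned by words in L_x and U_xy applied to a
    generator ([span_opval]), and in degree n each of these is a substitution instance of one of
    finitely many multilinear ones ([opcodes]). The finite checks are computations with integral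
    formal sums; a formal sum with zero normal form vanishes under every evaluation ([evl_norm0],
    [val_nf]).

    The rank of P is its trace ([rank_idempotent]), and a place permutation with c cycles fixes D ^
    c words ([card_fixed]), so 2N dim M_n(D) is an explicit integral polynomial in D. In
    characteristic zero the equality in K is an equality of integers ([zr_inj]), which is compared
    with binomial coefficients.

    For the correction in degree 7, the image of the Young symmetrizer has dimension D^2 (D^2 - 1)
    (D^2 - 4) (D - 3) / 144 by the same trace argument ([young_dim]). It is simple because every
    nonzero stable subspace contains the highest weight vector ([stable_hw]), and this vector
    generates everything ([stable_full]). *)

Notation fsum := (seq (Z * seq nat)).

Definition fscale (k : Z) (E : fsum) : fsum := [seq (Z.mul k p.1, p.2) | p <- E].

Definition fbind (f : seq nat -> fsum) (E : fsum) : fsum :=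
  flatten [seq fscale p.1 (f p.2) | p <- E].

Definition fmap_words (f : seq nat -> seq nat) (E : fsum) : fsum :=
  [seq (p.1, f p.2) | p <- E].

Fixpoint lexle (s t : seq nat) : bool :=
  match s, t with
  | [::], _ => true
  | _ :: _, [::] => false
  | a :: s', b :: t' => if (a == b)%N then lexle s' t' else (a < b)%N
  end.

Fixpoint collect (E : fsum) : fsum :=
  if E is p :: E' then
    if collect E' is q :: R then
      if p.2 == q.2 then (Z.add p.1 q.1, p.2) :: R else p :: q :: R
    else [:: p]
  else [::].

Definition fnorm (E : fsum) : fsum :=
  [seq p <- collect (sort (fun p q => lexle p.2 q.2) E) | ~~ Z.eqb p.1 Z0].

Section Evaluation.
Context {K : fieldType} {V : lmodType K}.
Implicit Types (F G : seq nat -> V) (E : fsum).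

Definition zr (z : Z) : K := (int_of_Z z)%:~R.

Lemma zr0 : zr Z0 = 0. Proof. by []. Qed.

Lemma zrD a b : zr (Z.add a b) = zr a + zr b.
Proof. by rewrite /zr -intrD -(rmorphD int_of_Z). Qed.

Lemma zrM a b : zr (Z.mul a b) = zr a * zr b.
Proof. by rewrite /zr -intrM -(rmorphM int_of_Z). Qed.

Definition evl F E : V := \sum_(p <- E) zr p.1 *: F p.2.

Lemma evl_nil F : evl F [::] = 0. Proof. exact: big_nil. Qed.

Lemma evl_cons F p E : evl F (p :: E) = zr p.1 *: F p.2 + evl F E.
Proof. exact: big_cons. Qed.

Lemma evl1 F p : evl F [:: p] = zr p.1 *: F p.2.
Proof. by rewrite evl_cons evl_nil addr0. Qed.

Lemma evl_cat F E1 E2 : evl F (E1 ++ E2) = evl F E1 + evl F E2.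
Proof. exact: big_cat. Qed.

Lemma evl_scale F k E : evl F (fscale k E) = zr k *: evl F E.
Proof.
rewrite /evl big_map scaler_sumr; apply: eq_bigr => p _.
by rewrite zrM scalerA.
Qed.

Lemma eq_evl_in F G E :
  (forall p, p \in E -> F p.2 = G p.2) -> evl F E = evl G E.
Proof.
by move=> FG; rewrite /evl big_seq [RHS]big_seq; apply: eq_bigr => p /FG->.
Qed.

Lemma eq_evl F G E : F =1 G -> evl F E = evl G E.
Proof. by move=> FG; apply: eq_evl_in => p _; apply: FG. Qed.

Lemma evl_zero F E : (forall p, p \in E -> F p.2 = 0) -> evl F E = 0.
Proof.
by move=> F0; rewrite /evl big_seq big1 // => p /F0->; rewrite scaler0.
Qed.

Lemma evl_flatten F (s : seq fsum) : evl F (flatten s) = \sum_(E <- s) evl F E.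
Proof.
elim: s => [|E s IH] /=; first by rewrite evl_nil big_nil.
by rewrite evl_cat IH big_cons.
Qed.

Lemma evl_bind F G f E :
  (forall m, evl G (f m) = F m) -> evl G (fbind f E) = evl F E.
Proof.
move=> FG; rewrite /fbind evl_flatten big_map; apply: eq_bigr => p _.
by rewrite evl_scale FG.
Qed.

Lemma evl_fmap F f E : evl F (fmap_words f E) = evl (F \o f) E.
Proof. by rewrite /evl big_map. Qed.

Lemma evl_collect F E : evl F (collect E) = evl F E.
Proof.
elim: E => [|p E IH] //=; rewrite evl_cons -IH.
case: (collect E) => [|q R]; first by rewrite evl1 evl_nil addr0.
case: eqP => [pq|_]; last by rewrite !evl_cons.
by rewrite !evl_cons /= zrD scalerDl pq addrA.
Qed.

Lemma evl_norm F E : evl F (fnorm E) = evl F E.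
Proof.
have -> : evl F E = evl F (sort (fun p q => lexle p.2 q.2) E).
  by apply: perm_big; rewrite perm_sym perm_sort.
rewrite -[RHS]evl_collect /fnorm; elim: (collect _) => [|p R IH] //=.
case: (Z.eqb_spec p.1 Z0) => [p0|_] /=; last by rewrite !evl_cons IH.
by rewrite IH evl_cons p0 scale0r add0r.
Qed.

Lemma evl_norm0 F E : fnorm E = [::] -> evl F E = 0.
Proof. by move=> E0; rewrite -evl_norm E0 evl_nil. Qed.

(** The reflection principle: one computation with integral coefficients proves an identity for all
    values of the words, in every module. *)
Lemma fnorm_sub F E1 E2 :
  fnorm (E1 ++ fscale (Zneg xH) E2) = [::] -> evl F E1 = evl F E2.
Proof.
move/(evl_norm0 F); rewrite evl_cat evl_scale scaleN1r => /eqP.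
by rewrite subr_eq0 => /eqP.
Qed.

End Evaluation.

Lemma evl_linear (K : fieldType) (V W : lmodType K) (h : {linear V -> W})
  (F : seq nat -> V) E : h (evl F E) = evl (h \o F) E.
Proof.
by rewrite /evl linear_sum; apply: eq_bigr => p _; rewrite linearZ.
Qed.

(** * Signed sorting, operator words and their normal forms *)

Definition zsign (b : bool) : Z := if b then Zneg xH else Zpos xH.

(** The Boolean is the parity of the number of adjacent transpositions performed, so that [isort]
    returns the sign of the sorting permutation. *)
Fixpoint insort (a : nat) (w : seq nat) : bool * seq nat :=
  if w is b :: w' then
    if (a <= b)%N then (false, a :: w)
    else let: (e, r) := insort a w' in (~~ e, b :: r)
  else (false, [:: a]).

Fixpoint isort (w : seq nat) : bool * seq nat :=
  if w is a :: w' then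
    let: (e, r) := isort w' in let: (e', r') := insort a r in (e (+) e', r')
  else (false, [::]).

Fixpoint stutter (w : seq nat) : bool :=
  if w is a :: w' then
    (if w' is b :: _ then (a == b)%N else false) || stutter w'
  else false.

Section Alternating.
Context {K : fieldType} {V : lmodType K}.
Hypothesis two_neq0 : (2%:R : K) != 0.
Variables (n : nat) (F : seq nat -> V).
Hypothesis alt : forall u a b v, size (u ++ a :: b :: v) = n ->
  F (u ++ a :: b :: v) = - F (u ++ b :: a :: v).

Lemma zr_sign b : zr (zsign b) = (-1) ^+ b :> K.
Proof. by case: b. Qed.

Lemma size_insort a w : size (insort a w).2 = (size w).+1.
Proof.
elim: w => //= b w IH; case: ifP => //= _.
by case: (insort a w) IH => e r /= ->.
Qed.

Lemma size_isort w : size (isort w).2 = size w.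
Proof.
elim: w => //= a w IH; case: (isort w) IH => e r /= <-.
by have := size_insort a r; case: (insort a r).
Qed.

Lemma insort_alt u a w : size (u ++ a :: w) = n ->
  F (u ++ a :: w) = (-1) ^+ (insort a w).1 *: F (u ++ (insort a w).2).
Proof.
elim: w u => [|b w IH] u /= sz; first by rewrite scale1r.
case: ifP => [_|_]; first by rewrite scale1r.
rewrite alt // -cat_rcons IH; last by rewrite cat_rcons -sz !size_cat.
by case: (insort a w) => e r /=; rewrite cat_rcons -scaleNr signrN.
Qed.

Lemma isort_alt u w : size (u ++ w) = n ->
  F (u ++ w) = (-1) ^+ (isort w).1 *: F (u ++ (isort w).2).
Proof.
elim: w u => [|a w IH] u sz; first by rewrite scale1r.
rewrite -cat_rcons IH ?cat_rcons //= => {IH}.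
have := size_isort w; case: (isort w) => e r /= szr.
rewrite insort_alt ?cat_rcons; last by rewrite -sz !size_cat /= szr.
by case: (insort a r) => e' r'; rewrite scalerA signr_addb.
Qed.

Lemma stutter_alt u w : size (u ++ w) = n -> stutter w -> F (u ++ w) = 0.
Proof.
elim: w u => [|a w IH] u //= sz /orP[|st]; last first.
  by rewrite -cat_rcons IH // cat_rcons.
case: w IH sz => // b w IH sz /eqP ab; rewrite -{}ab in sz *.
have := alt sz; move/eqP; rewrite -addr_eq0 -mulr2n -scaler_nat scaler_eq0.
by rewrite (negPf two_neq0) => /eqP.
Qed.

End Alternating.

(* A formal operator word: [0 :: w] is the associative word w, [1 :: i :: m]  *)
(* stands for x_i m + m x_i, [2 :: i :: j :: m] for x_i m x_j + x_j m x_i and *)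
(* [3 :: w], with w of length 4, for the alternating sum of all rearrangements *)
(* of w.                                                                      *)
Definition alt4 : fsum :=
  [seq (zsign (isort s).1, s) | s <- permutations (iota 0 4)].

Fixpoint relab (s m : seq nat) : seq nat :=
  match m with
  | 0 :: w => 0%N :: map (nth 0%N s) w
  | 1 :: i :: m' => 1%N :: nth 0%N s i :: relab s m'
  | 2 :: i :: j :: m' => 2%N :: nth 0%N s i :: nth 0%N s j :: relab s m'
  | 3 :: w => 3%N :: map (nth 0%N s) w
  | _ => [::]
  end.

Definition frelab s : fsum -> fsum := fmap_words (relab s).

Fixpoint full (m : seq nat) : fsum :=
  match m with
  | 0 :: w => [:: (Zpos xH, w)]
  | 1 :: i :: m' =>
      fbind (fun w => [:: (Zpos xH, i :: w); (Zpos xH, rcons w i)]) (full m')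
  | 2 :: i :: j :: m' =>
      fbind (fun w => [:: (Zpos xH, i :: rcons w j); (Zpos xH, j :: rcons w i)])
        (full m')
  | 3 :: w => if size w == 4%N then fmap_words (map (nth 0%N w)) alt4 else [::]
  | _ => [::]
  end.

Definition push1 (i : nat) (u : seq nat) : fsum :=
  if u is 0 :: w then
    [:: (Zpos xH, [:: 0, i & w]%N); (Zpos xH, 0%N :: rcons w i)]
  else [:: (Zpos xH, [:: 1, i & u]%N)].

Definition push2 (i j : nat) (u : seq nat) : fsum :=
  if u is 0 :: w then
    [:: (Zpos xH, [:: 0, i & rcons w j]%N); (Zpos xH, [:: 0, j & rcons w i]%N)]
  else [:: (Zpos xH, [:: 2, minn i j, maxn i j & u]%N)].

(** Operators are multiplied out only when they act on an associative word. In front of an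
    alternating sum they are kept, with the two letters of each U ordered; the alternating sum
    itself is sorted with sign. Unlike [full], this keeps relations between operators on T short. *)
Fixpoint expand (m : seq nat) : fsum :=
  match m with
  | 1 :: i :: m' => fbind (push1 i) (expand m')
  | 2 :: i :: j :: m' => fbind (push2 i j) (expand m')
  | 3 :: w =>
      if size w == 4%N then
        let: (e, w') := isort w in
        if stutter w' then [::] else [:: (zsign e, 3%N :: w')]
      else [:: (Zpos xH, m)]
  | _ => [:: (Zpos xH, m)]
  end.

Definition fnf (E : fsum) : fsum := fnorm (fbind expand E).

Definition pal (w : seq nat) : fsum :=
  [:: (Zpos xH, 0%N :: w); (Zpos xH, 0%N :: rev w)].

#[local] Opaque alt4.

Section Values.
Context {K : fieldType} {A : lalgType K}.
Hypothesis mulZr : forall (a : K) (f g : A), f * (a *: g) = a *: (f * g).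
Implicit Types (x : nat -> A) (E : fsum).

Definition word x (w : seq nat) : A := \prod_(i <- w) x i.

Lemma word_cons x i w : word x (i :: w) = x i * word x w.
Proof. exact: big_cons. Qed.

Lemma word_rcons x i w : word x (rcons w i) = word x w * x i.
Proof. by rewrite /word -cats1 big_cat big_seq1. Qed.

Definition wordE := (word_cons, word_rcons).

Fixpoint opval x (m : seq nat) : A :=
  match m with
  | 0 :: w => word x w
  | 1 :: i :: m' => x i * opval x m' + opval x m' * x i
  | 2 :: i :: j :: m' => x i * opval x m' * x j + x j * opval x m' * x i
  | 3 :: w => if size w == 4%N then evl (word x) (fmap_words (map (nth 0%N w)) alt4) else 0
  | _ => 0
  end.

Definition lact (f : A) (g : A) : A := f * g + g * f.
Definition uact (f h : A) (g : A) : A := f * g * h + h * g * f.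

Lemma lact_linear (f : A) : linear (lact f).
Proof.
move=> a g h; rewrite /lact mulrDr mulrDl mulZr -scalerAl scalerDr.
by rewrite -!addrA; congr (_ + _); rewrite addrCA.
Qed.

Lemma uact_linear (f h : A) : linear (uact f h).
Proof.
move=> a g g'; rewrite /uact.
have E u v : u * (a *: g + g') * v = a *: (u * g * v) + u * g' * v.
  by rewrite mulrDr mulrDl mulZr -scalerAl.
by rewrite !E scalerDr -!addrA; congr (_ + _); rewrite addrCA.
Qed.

Lemma mul_evl f (F : seq nat -> A) E : f * evl F E = evl (fun m => f * F m) E.
Proof.
by rewrite /evl big_distrr; apply: eq_bigr => p _ /=; rewrite mulZr.
Qed.

Lemma evl_mul f (F : seq nat -> A) E : evl F E * f = evl (fun m => F m * f) E.
Proof.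
by rewrite /evl big_distrl; apply: eq_bigr => p _; rewrite scalerAl.
Qed.

Lemma evlD (F G : seq nat -> A) E :
  evl F E + evl G E = evl (fun m => F m + G m) E.
Proof. by rewrite /evl -big_split; apply: eq_bigr => p _; rewrite scalerDr. Qed.

Lemma evl_lact F f E : lact f (evl F E) = evl (fun m => lact f (F m)) E.
Proof. by rewrite /lact mul_evl evl_mul evlD. Qed.

Lemma evl_uact F f h E : uact f h (evl F E) = evl (fun m => uact f h (F m)) E.
Proof. by rewrite /uact mul_evl (mul_evl h) evl_mul (evl_mul f) evlD. Qed.

Lemma val_full x m : evl (word x) (full m) = opval x m.
Proof.
have [k] := ubnP (size m); elim: k m => // k IH [|[|[|[|[|j]]]] m] //= szm.
- by rewrite evl_nil.
- by rewrite evl1 scale1r.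
- case: m szm => [|i m] szm /=; first by rewrite evl_nil.
  rewrite -/(lact _ _) -IH; last by rewrite ltnW.
  rewrite evl_lact; apply: evl_bind => w.
  by rewrite evl_cons evl1 /= !scale1r !wordE.
- case: m szm => [|i [|j m]] szm /=; rewrite ?evl_nil //.
  rewrite -/(uact _ _ _) -IH; last by rewrite ltnW // ltnW.
  rewrite evl_uact; apply: evl_bind => w.
  by rewrite evl_cons evl1 /= !scale1r !wordE !mulrA.
- by case: ifP => // _; rewrite evl_nil.
- by rewrite evl_nil.
Qed.

Lemma mem_alt4 p i : p \in alt4 -> i \in p.2 -> (i < 4)%N.
Proof.
case/mapP => s; rewrite mem_permutations => /perm_mem si -> /=.
by rewrite si mem_iota.
Qed.

Lemma val_relab x s m : opval x (relab s m) = opval (x \o nth 0%N s) m.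
Proof.
have [k] := ubnP (size m); elim: k m => // k IH [|[|[|[|[|j]]]] m] //= szm.
- by rewrite /word big_map.
- by case: m szm => [|i m] szm //=; rewrite IH // ltnW.
- by case: m szm => [|i [|j m]] szm //=; rewrite IH // ltnW // ltnW.
rewrite size_map; case: eqP => // sz4.
rewrite !evl_fmap; apply: eq_evl_in => p p_alt4 /=.
rewrite /word !big_map [LHS]big_seq [RHS]big_seq; apply: eq_bigr => i ip /=.
by rewrite (nth_map 0%N) // sz4; apply: mem_alt4 ip.
Qed.

Lemma evl_relab x s E : evl (opval x) (frelab s E) = evl (opval (x \o nth 0%N s)) E.
Proof. by rewrite evl_fmap; apply: eq_evl => m; apply: val_relab. Qed.

Definition swap4 (i : nat) (w : seq nat) : seq nat :=
  map (nth 0%N (take i (iota 0 4) ++ [:: i.+1; i] ++ drop i.+2 (iota 0 4))) w.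

Lemma alt4_swap (F : seq nat -> A) i : (i < 3)%N ->
  evl F (fmap_words (swap4 i) alt4) = - evl F alt4.
Proof.
move=> i3; apply/eqP; rewrite -addr_eq0 -evl_cat; apply/eqP/evl_norm0.
by case: i i3 => [|[|[|i]]] // _; vm_compute.
Qed.

(** Exchanging two neighbouring letters amounts to composing [alt4] with a transposition of
    positions, which negates it by [alt4_swap]. *)
Lemma val_alt x u a b v : size (u ++ a :: b :: v) = 4%N ->
  opval x (3%N :: u ++ a :: b :: v) = - opval x (3%N :: u ++ b :: a :: v).
Proof.
case: u => [|c [|d [|e u]]]; case: v => [|f [|g [|h v]]] //=; rewrite ?size_cat ?addnS //=.
- move=> _; rewrite !evl_fmap -(@alt4_swap _ 0) // evl_fmap.
  apply: eq_evl_in => p p_alt4 /=; congr word; rewrite -map_comp.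
  by apply/eq_in_map => i /(mem_alt4 p_alt4); case: i => [|[|[|[|i]]]].
- move=> _; rewrite !evl_fmap -(@alt4_swap _ 1) // evl_fmap.
  apply: eq_evl_in => p p_alt4 /=; congr word; rewrite -map_comp.
  by apply/eq_in_map => i /(mem_alt4 p_alt4); case: i => [|[|[|[|i]]]].
- move=> _; rewrite !evl_fmap -(@alt4_swap _ 2) // evl_fmap.
  apply: eq_evl_in => p p_alt4 /=; congr word; rewrite -map_comp.
  by apply/eq_in_map => i /(mem_alt4 p_alt4); case: i => [|[|[|[|i]]]].
Qed.

Lemma evl_push1 x i u : evl (opval x) (push1 i u) = lact (x i) (opval x u).
Proof.
case: u => [|[|j] w]; first by rewrite /push1 evl1 scale1r.
  by rewrite evl_cons evl1 !scale1r /lact -word_cons -word_rcons.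
by rewrite /push1 evl1 scale1r.
Qed.

Lemma evl_push2 x i j u : evl (opval x) (push2 i j u) = uact (x i) (x j) (opval x u).
Proof.
have sym f g h : uact f h g = uact h f g :> A by rewrite /uact addrC.
case: u => [|[|k] w]; last first.
- rewrite /push2 evl1 scale1r -[LHS]/(uact (x (minn i j)) (x (maxn i j)) _).
  by rewrite /minn /maxn; case: ifP.
- rewrite evl_cons evl1 !scale1r -[RHS]/(uact (x i) (x j) (word x w)).
  rewrite -[opval x _]/(word x (i :: rcons w j)).
  by rewrite -[opval x _]/(word x (j :: rcons w i)) /uact !wordE !mulrA.
- rewrite /push2 evl1 scale1r -[LHS]/(uact (x (minn i j)) (x (maxn i j)) _).
  by rewrite /minn /maxn; case: ifP.
Qed.

Lemma val_expand x m : (2%:R : K) != 0 -> evl (opval x) (expand m) = opval x m.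
Proof.
move=> two_neq0.
have [k] := ubnP (size m); elim: k m => // k IH [|[|[|[|[|j]]]] m] //= szm;
  rewrite ?evl1 ?scale1r //=.
- case: m szm => [|i m] szm /=; first by rewrite evl1 scale1r.
  rewrite -/(lact _ _) -IH; last by rewrite ltnW.
  by rewrite evl_lact; apply: evl_bind => u; apply: evl_push1.
- case: m szm => [|i [|j m]] szm /=; rewrite ?evl1 ?scale1r //.
  rewrite -/(uact _ _ _) -IH; last by rewrite ltnW // ltnW.
  by rewrite evl_uact; apply: evl_bind => u; apply: evl_push2.
case: ifP => [/eqP sz4|sz4]; last by rewrite evl1 /= sz4 scale1r.
have := @isort_alt K A 4 (fun w => opval x (3%N :: w)) (val_alt x) [::] m sz4.
have := @stutter_alt K A two_neq0 4 (fun w => opval x (3%N :: w)) (val_alt x) [::] (isort m).2.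
rewrite !cat0s size_isort; case: (isort m) => e w /= st /=; rewrite sz4 /= => ->.
case: ifP => [w_st|_]; last by rewrite evl1 /= zr_sign.
by rewrite evl_nil; move: (st sz4 w_st) => /= ->; rewrite scaler0.
Qed.

Lemma val_nf x E : (2%:R : K) != 0 -> evl (opval x) (fnf E) = evl (opval x) E.
Proof. by move=> two_neq0; rewrite evl_norm; apply: evl_bind => m; apply: val_expand. Qed.

Lemma val_ext (x y : nat -> A) m : x =1 y -> opval x m = opval y m.
Proof.
move=> xy; have [k] := ubnP (size m); elim: k m => // k IH [|[|[|[|[|j]]]] m] //= szm.
- by rewrite /word; apply: eq_bigr => i _; apply: xy.
- by case: m szm => [|i m] // szm; rewrite IH ?xy // ltnW.
- by case: m szm => [|i [|j m]] // szm; rewrite IH ?xy // ltnW // ltnW.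
case: eqP => // _; apply: eq_evl => w; rewrite /word.
by apply: eq_bigr => i _; apply: xy.
Qed.

Lemma evl_pal x w : evl (opval x) (pal w) = word x w + word x (rev w).
Proof. by rewrite evl_cons evl1 !scale1r. Qed.

Definition fmul (E1 E2 : fsum) : fsum :=
  fbind (fun u => fmap_words (cat u) E2) E1.

Definition flact (E1 E2 : fsum) : fsum := fmul E1 E2 ++ fmul E2 E1.

Lemma evl_fmul x E1 E2 :
  evl (word x) (fmul E1 E2) = evl (word x) E1 * evl (word x) E2.
Proof.
rewrite evl_mul; apply: evl_bind => u; rewrite evl_fmap mul_evl.
by apply: eq_evl => w; rewrite /= /word big_cat.
Qed.

Lemma evl_flact x E1 E2 :
  evl (word x) (flact E1 E2) = lact (evl (word x) E1) (evl (word x) E2).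
Proof. by rewrite evl_cat !evl_fmul. Qed.

Definition fvar (i : nat) : fsum := [:: (Zpos xH, [:: i])].

Lemma evl_fvar x i : evl (word x) (fvar i) = x i.
Proof. by rewrite evl1 scale1r /word big_seq1. Qed.

(** This expresses the polarised quadratic operator U by Jordan products, so SJ is closed under it.
    As an identity between noncommutative polynomials in three letters it is checked formally. *)
Lemma lact_uact f h g :
  2%:R *: uact f h g
  = lact f (lact h g) + lact h (lact f g) - lact (lact f h) g.
Proof.
pose x i := nth 0 [:: f; h; g] i.
have -> : uact f h g = evl (word x) (full [:: 2; 0; 1; 0; 2]%N).
  by rewrite val_full /= /word big_seq1.
rewrite -[f]/(x 0%N) -[h]/(x 1%N) -[g]/(x 2%N) -!(evl_fvar x) -!evl_flact.
rewrite -[2%:R]/(zr (Zpos (xO xH))) -scaleN1r -[-1]/(zr (Zneg xH)) -!evl_scale.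
by rewrite -!evl_cat; apply: fnorm_sub; vm_compute.
Qed.

(* The linearised Jordan identity, as a formula for multiplication by (ab)c.  *)
Lemma lact_lact a b c h :
  lact (lact (lact a b) c) h
  = lact (lact a b) (lact c h) + lact (lact b c) (lact a h)
    + lact (lact a c) (lact b h)
    - lact a (lact c (lact b h)) - lact b (lact c (lact a h)).
Proof.
pose x i := nth 0 [:: a; b; c; h] i.
rewrite -[a]/(x 0%N) -[b]/(x 1%N) -[c]/(x 2%N) -[h]/(x 3%N).
rewrite -!(evl_fvar x) -!evl_flact -!scaleN1r -[-1]/(zr (Zneg xH)) -!evl_scale.
by rewrite -!evl_cat; apply: fnorm_sub; vm_compute.
Qed.

End Values.

(** * Relations modulo the special Jordan algebra *)

Delimit Scope Z_scope with BZ.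

Definition flop (i : nat) : fsum -> fsum := fmap_words (fun m => [:: 1, i & m]%N).

Definition fuop (i j : nat) : fsum -> fsum :=
  fmap_words (fun m => [:: 2, i, j & m]%N).

(* [rel4] as a combination of Jordan words, found by linear algebra. *)
Definition cert4 : fsum := (
  [:: (4, [:: 2; 0; 3; 1; 2; 0; 1]%N); (2, [:: 1; 0; 1; 1; 1; 2; 0; 3]%N);
      (1, [:: 1; 3; 1; 2; 1; 1; 0; 0]%N); (-1, [:: 1; 1; 1; 2; 1; 0; 0; 3]%N);
      (2, [:: 1; 2; 1; 0; 1; 1; 0; 3]%N); (-3, [:: 1; 0; 1; 2; 1; 1; 0; 3]%N);
      (4, [:: 1; 3; 2; 0; 2; 0; 1]%N); (-4, [:: 2; 2; 3; 1; 1; 0; 0]%N)])%BZ.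

Definition rel4 : fsum :=
  fscale 12 (pal (iota 0 4)) ++ [:: ((-1)%BZ, 3%N :: iota 0 4)].

(* In odd degree n the rotation sum telescopes to twice the palindrome.       *)
Definition rotrel (n : nat) (E : fsum) : fsum :=
  fnf (flatten [seq fscale (zsign (odd k))
                      (flop k (frelab (behead (rot k (iota 0 n))) E))
               | k <- iota 0 n]).

Definition rel5 : fsum := rotrel 5 rel4.

(* The coefficients, found by linear algebra, of a combination of the        *)
(* relations L_i [rel5] and U_ij [rel4] in which the only associative words  *)
(* are those of 192 {x_0 ... x_5}.                                           *)
Definition cert6 : fsum := (
  [:: (4, [:: 1; 5; 0; 1; 2; 3; 4]%N); (-3, [:: 1; 1; 0; 3; 2; 4; 5]%N);
      (-3, [:: 1; 3; 0; 1; 5; 4; 2]%N); (3, [:: 1; 0; 1; 5; 4; 2; 3]%N);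
      (3, [:: 1; 0; 1; 5; 4; 3; 2]%N); (-3, [:: 1; 2; 0; 1; 5; 4; 3]%N);
      (4, [:: 2; 2; 3; 0; 1; 5; 4]%N); (4, [:: 1; 0; 1; 2; 3; 4; 5]%N);
      (-4, [:: 2; 0; 1; 2; 3; 4; 5]%N); (4, [:: 2; 1; 5; 0; 3; 2; 4]%N);
      (2, [:: 1; 1; 0; 5; 3; 2; 4]%N); (-2, [:: 1; 0; 1; 4; 2; 3; 5]%N);
      (2, [:: 2; 0; 5; 1; 4; 2; 3]%N); (-2, [:: 1; 5; 0; 3; 2; 4; 1]%N);
      (-2, [:: 2; 1; 4; 0; 5; 3; 2]%N); (2, [:: 1; 4; 0; 5; 3; 2; 1]%N);
      (-4, [:: 2; 0; 4; 1; 2; 3; 5]%N); (4, [:: 1; 4; 0; 1; 2; 3; 5]%N);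
      (-4, [:: 2; 4; 5; 0; 1; 2; 3]%N); (-2, [:: 1; 1; 4; 2; 3; 0; 5]%N);
      (-2, [:: 2; 0; 5; 3; 2; 1; 4]%N); (2, [:: 1; 5; 0; 3; 2; 1; 4]%N);
      (2, [:: 1; 0; 4; 1; 2; 3; 5]%N); (2, [:: 2; 1; 4; 2; 3; 0; 5]%N);
      (-2, [:: 1; 4; 1; 2; 3; 0; 5]%N); (-1, [:: 1; 3; 2; 0; 1; 5; 4]%N);
      (1, [:: 1; 4; 3; 2; 0; 1; 5]%N); (1, [:: 1; 1; 0; 2; 3; 4; 5]%N);
      (-1, [:: 1; 5; 1; 0; 2; 3; 4]%N); (1, [:: 1; 4; 2; 3; 0; 1; 5]%N);
      (-1, [:: 1; 2; 3; 0; 1; 5; 4]%N); (-1, [:: 1; 5; 1; 0; 3; 2; 4]%N)])%BZ.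

Definition cert6_term (m : seq nat) : fsum :=
  match m with
  | 1 :: i :: w => flop i (frelab w rel5)
  | 2 :: i :: j :: w => fscale 2 (fuop i j (frelab w rel4))
  | _ => [::]
  end.

Definition rel6 : fsum := fnf (fbind cert6_term cert6).

Definition rel7_pre : fsum := rotrel 7 rel6.

(* In degree 7 the elements L_u L_v L_w T(a, b, c, d) satisfy linear         *)
(* relations modulo SJ. These form an S_7-module of type (3,2,1,1), generated *)
(* by [syz], and [syz_proj] / 9216 projects onto it. The projection has to be *)
(* subtracted from [rel7_pre] for the associated operator to kill SJ.        *)
Definition syz_edge : fsum :=
  fnf (frelab [:: 0; 6; 3; 4; 1; 2; 5]%N rel7_pre
    ++ frelab [:: 0; 2; 1; 4; 3; 6; 5]%N rel7_pre
    ++ fscale (-16) (fuop 0 5 (frelab [:: 6; 3; 4; 1; 2]%N rel5))).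

(** The associative words cancel in [syz_edge]: [rel7_pre] contains 384 {w}, and 384 ({0634125} +
    {0214365}) is 16 times U_05 applied to 24 {63412}, as 21436 is the reversal of 63412. Only
    operators on T remain. The sum over the permutations of 012 and 34 is the row symmetrizer of
    shape (3,2,1,1). *)
Definition syz : fsum :=
  fnf (flatten [seq frelab (p ++ q ++ [:: 5; 6]%N) syz_edge
               | p <- permutations [:: 0; 1; 2]%N, q <- permutations [:: 3; 4]%N]).

(** Alternating in the letters 3, 4, 5, 6, as T is, so that L_0 L_1 L_2 T(3, 4, 5, 6) |-> [syz_proj]
    is compatible with relabelling; [syz_term] is this map on the other letters. *)
Definition syz_proj : fsum :=
  fnf (flatten
    [seq fscale (zsign (isort q).1)
           (frelab (map (nth 0%N (0%N :: p ++ q)) [:: 1; 2; 3; 0; 4; 5; 6]%N) syz)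
    | p <- permutations [:: 1; 2]%N, q <- permutations [:: 3; 4; 5; 6]%N]).

Definition syz_term (m : seq nat) : fsum :=
  if m is [:: 1, u, 1, v, 1, w, 3 & t]%N then frelab [:: u, v, w & t] syz_proj
  else [::].

Definition rel7 : fsum :=
  fnf (fscale 9216 rel7_pre ++ fscale (-1) (fbind syz_term rel7_pre)).

(** When E has the form N {w} - q, with q a combination of operators on T, this is q. *)
Definition quo (E : fsum) : fsum :=
  fscale (-1) [seq p <- E | head 0%N p.2 != 0%N].

Section Membership.
Context {K : fieldType}.
Hypothesis charK0 : [pchar K] =i pred0.

Lemma natr_char0 n : (n%:R == 0 :> K) = (n == 0%N).
Proof. by move/pcharf0P: charK0 => ->. Qed.

Lemma two_neq0 : (2%:R : K) != 0.
Proof. by rewrite natr_char0. Qed.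

Lemma malg_mulZr D (a : K) (f g : free_alg K D) : f * (a *: g) = a *: (f * g).
Proof.
apply/malgP => w; rewrite mcoeffZ (mcoeffMlw _ (d1 := msupp f) (d2 := msupp g));
  rewrite ?fsubset_refl ?msuppZ_le //.
rewrite (mcoeffMlw _ (d1 := msupp f) (d2 := msupp g)) ?fsubset_refl //.
rewrite mulr_sumr; apply: eq_bigr => u _; rewrite mulr_sumr.
by apply: eq_bigr => v _; rewrite mcoeffZ !mulrnAr mulrCA.
Qed.

Lemma SJ_scale D (a : K) (f : free_alg K D) : SJ f -> SJ (a *: f).
Proof. by move=> Sf; rewrite -[_ *: f]addr0; apply: SJ_lin => //; apply: SJ_0. Qed.

Lemma SJ_add D (f g : free_alg K D) : SJ f -> SJ g -> SJ (f + g).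
Proof. by move=> Sf Sg; rewrite -[f]scale1r; apply: SJ_lin. Qed.

Lemma SJ_lact D (f g : free_alg K D) : SJ f -> SJ g -> SJ (lact f g).
Proof.
move=> Sf Sg; have -> : lact f g = 2%:R *: jprod f g.
  by rewrite /jprod scalerA divff ?two_neq0 // scale1r.
exact/SJ_scale/SJ_mul.
Qed.

Lemma SJ_uact D (f h g : free_alg K D) : SJ f -> SJ h -> SJ g -> SJ (uact f h g).
Proof.
move=> Sf Sh Sg.
have -> : uact f h g = 2^-1 *: (2%:R *: uact f h g).
  by rewrite scalerA mulVf ?two_neq0 // scale1r.
rewrite (lact_uact (@malg_mulZr D)).
apply: SJ_scale; rewrite addrC -scaleN1r; apply: SJ_lin.
  by apply: SJ_lact => //; apply: SJ_lact.
by apply: SJ_add; apply: SJ_lact => //; apply: SJ_lact.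
Qed.

Lemma SJ_evl D (F : seq nat -> free_alg K D) E :
  (forall p, p \in E -> SJ (F p.2)) -> SJ (evl F E).
Proof.
elim: E => [|p E IH] SF; first by rewrite evl_nil; apply: SJ_0.
rewrite evl_cons; apply: SJ_lin; first by apply: SF; rewrite mem_head.
by apply: IH => q qE; apply: SF; rewrite in_cons qE orbT.
Qed.

(** Allowing all substitutions from SJ, and all D, makes the property stable under relabelling of
    letters. *)
Definition in_SJ (E : fsum) : Prop :=
  forall D (x : nat -> free_alg K D), (forall i, SJ (x i)) -> SJ (evl (opval x) E).

Lemma in_SJ_nil : in_SJ [::].
Proof. by move=> D x _; rewrite evl_nil; apply: SJ_0. Qed.

Lemma in_SJ_cat E1 E2 : in_SJ E1 -> in_SJ E2 -> in_SJ (E1 ++ E2).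
Proof. by move=> S1 S2 D x Sx; rewrite evl_cat; apply: SJ_add; [apply: S1|apply: S2]. Qed.

Lemma in_SJ_flatten (s : seq fsum) :
  (forall E, E \in s -> in_SJ E) -> in_SJ (flatten s).
Proof.
elim: s => [|E s IH] SF; first exact: in_SJ_nil.
apply: in_SJ_cat; first by apply: SF; rewrite mem_head.
by apply: IH => u us; apply: SF; rewrite in_cons us orbT.
Qed.

Lemma in_SJ_scale k E : in_SJ E -> in_SJ (fscale k E).
Proof. by move=> S D x Sx; rewrite evl_scale; apply/SJ_scale/S. Qed.

Lemma in_SJ_bind f E : (forall m, in_SJ (f m)) -> in_SJ (fbind f E).
Proof. by move=> Sf; apply: in_SJ_flatten => _ /mapP[p _ ->]; apply: in_SJ_scale. Qed.

Lemma in_SJ_relab s E : in_SJ E -> in_SJ (frelab s E).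
Proof. by move=> S D x Sx; rewrite evl_relab; apply: S => i; apply: Sx. Qed.

Lemma in_SJ_nf E : in_SJ E -> in_SJ (fnf E).
Proof.
move=> S D x Sx; rewrite (val_nf (@malg_mulZr D)) ?two_neq0 //.
exact: S.
Qed.

Lemma in_SJ_flop i E : in_SJ E -> in_SJ (flop i E).
Proof.
move=> S D x Sx; rewrite evl_fmap -(evl_lact (@malg_mulZr D)).
by apply: SJ_lact => //; apply: S.
Qed.

Lemma in_SJ_fuop i j E : in_SJ E -> in_SJ (fuop i j E).
Proof.
move=> S D x Sx; rewrite evl_fmap -(evl_uact (@malg_mulZr D)).
by apply: SJ_uact => //; apply: S.
Qed.

Lemma in_SJ_rotrel n E : in_SJ E -> in_SJ (rotrel n E).
Proof.
move=> S; apply/in_SJ_nf/in_SJ_flatten => _ /mapP[k _ ->].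
exact/in_SJ_scale/in_SJ_flop/in_SJ_relab.
Qed.

Fixpoint jordan_word (m : seq nat) : bool :=
  match m with
  | [:: 0; _] => true
  | 1 :: _ :: m' => jordan_word m'
  | 2 :: _ :: _ :: m' => jordan_word m'
  | _ => false
  end.

Lemma SJ_jordan_word D (x : nat -> free_alg K D) m :
  (forall i, SJ (x i)) -> jordan_word m -> SJ (opval x m).
Proof.
move=> Sx; have [k] := ubnP (size m); elim: k m => // k IH [|[|[|[|j]]] m] // szm.
- by case: m szm => [|i [|j m]] // _ _; rewrite /= /word big_seq1.
- case: m szm => [|i m] // szm jm; apply: SJ_lact => //; apply: IH => //.
  exact: ltnW.
- case: m szm => [|i [|j m]] // szm jm; apply: SJ_uact => //; apply: IH => //.
  exact/ltnW/ltnW.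
Qed.

(** Fully multiplied out, [cert4] and [rel4] agree, and each term of [cert4] is a word of L and U
    operators applied to a single letter. *)
Lemma in_SJ_rel4 : in_SJ rel4.
Proof.
move=> D x Sx; have <- : evl (opval x) cert4 = evl (opval x) rel4.
  apply/esym; have vf := val_full (@malg_mulZr D) x.
  rewrite -!(evl_bind _ vf); apply: fnorm_sub; vm_compute.
  by [].
apply: SJ_evl => p; have: all (fun p => jordan_word p.2) cert4 by [].
by move/allP => jw /jw; apply: SJ_jordan_word.
Qed.

Lemma in_SJ_rel6 : in_SJ rel6.
Proof.
apply/in_SJ_nf/in_SJ_bind => -[|[|[|[|j]]] m]; try exact: in_SJ_nil.
- case: m => [|i m]; first exact: in_SJ_nil.
  exact/in_SJ_flop/in_SJ_relab/in_SJ_rotrel/in_SJ_rel4.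
- case: m => [|i [|j m]]; try exact: in_SJ_nil.
  exact/in_SJ_scale/in_SJ_fuop/in_SJ_relab/in_SJ_rel4.
Qed.

Lemma in_SJ_rel7_pre : in_SJ rel7_pre.
Proof. exact/in_SJ_rotrel/in_SJ_rel6. Qed.

Lemma in_SJ_syz : in_SJ syz.
Proof.
apply/in_SJ_nf/in_SJ_flatten => _ /allpairsPdep[p [q [_ _ ->]]].
apply/in_SJ_relab/in_SJ_nf/in_SJ_cat; first exact/in_SJ_relab/in_SJ_rel7_pre.
apply/in_SJ_cat; first exact/in_SJ_relab/in_SJ_rel7_pre.
exact/in_SJ_scale/in_SJ_fuop/in_SJ_relab/in_SJ_rotrel/in_SJ_rel4.
Qed.

Lemma in_SJ_rel7 : in_SJ rel7.
Proof.
apply/in_SJ_nf/in_SJ_cat; apply/in_SJ_scale; first exact: in_SJ_rel7_pre.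
apply/in_SJ_bind => m; rewrite /syz_term.
repeat match goal with |- in_SJ (match ?t with _ => _ end) => destruct t end;
  try exact: in_SJ_nil.
apply/in_SJ_relab/in_SJ_nf/in_SJ_flatten => _ /allpairsPdep[p [q [_ _ ->]]].
exact/in_SJ_scale/in_SJ_relab/in_SJ_syz.
Qed.

End Membership.

(** * Spanning the special Jordan algebra by operator words *)

Inductive jtree (D : nat) := JLeaf of 'I_D | JNode of jtree D & jtree D.

Fixpoint jdeg D (t : jtree D) : nat :=
  if t is JNode l r then (jdeg l + jdeg r)%N else 1%N.

Lemma jdeg_gt0 D (t : jtree D) : (0 < jdeg t)%N.
Proof. by elim: t => //= l l0 r r0; rewrite addn_gt0 l0. Qed.

Section Span.
Context {K : fieldType} {V : lmodType K}.
Implicit Types (P : V -> Prop) (f g : V).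

Inductive spanned P : V -> Prop :=
| span_0 : spanned P 0
| span_cons (a : K) v f : P v -> spanned P f -> spanned P (a *: v + f).

Lemma span_in P v : P v -> spanned P v.
Proof.
by move=> Pv; rewrite -[v]scale1r -[_ *: v]addr0; apply: span_cons => //; apply: span_0.
Qed.

Lemma span_add P f g : spanned P f -> spanned P g -> spanned P (f + g).
Proof.
move=> Sf Sg; elim: Sf => [|a v h Pv _ IH]; first by rewrite add0r.
by rewrite -addrA; apply: span_cons.
Qed.

Lemma span_scale P a f : spanned P f -> spanned P (a *: f).
Proof.
elim=> [|b v h Pv _ IH]; first by rewrite scaler0; apply: span_0.
by rewrite scalerDr scalerA; apply: span_cons.
Qed.

Lemma span_opp P f : spanned P f -> spanned P (- f).
Proof. by rewrite -scaleN1r; apply: span_scale. Qed.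

End Span.

Lemma span_linear (K : fieldType) (V W : lmodType K) (P : V -> Prop)
  (Q : W -> Prop) (h : {linear V -> W}) f :
  (forall v, P v -> spanned Q (h v)) -> spanned P f -> spanned Q (h f).
Proof.
move=> PQ; elim=> [|a v g Pv _ IH]; first by rewrite linear0; apply: span_0.
by rewrite linearP; apply: span_add => //; apply/span_scale/PQ.
Qed.

(** The code c records the shape ([false] for L, [true] for U) and l the letters, so that a
    multilinear word is determined by its code alone. *)
Fixpoint opword (c : seq bool) (l : seq nat) : seq nat :=
  match c, l with
  | [::], _ => 0%N :: l
  | false :: c', i :: l' => [:: 1, i & opword c' l']%N
  | true :: c', i :: j :: l' => [:: 2, i, j & opword c' l']%N
  | _, _ => [::]
  end.

Fixpoint opdeg (c : seq bool) : nat :=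
  if c is b :: c' then (b.+1 + opdeg c')%N else 1%N.

Lemma relab_opword s c l : size l = opdeg c ->
  relab s (opword c l) = opword c (map (nth 0%N s) l).
Proof.
elim: c l => [|[] c IH] l //= szl.
  by case: l szl => [|i [|j l]] //= [szl]; rewrite IH.
by case: l szl => [|i l] //= [szl]; rewrite IH.
Qed.

Section OperatorSpan.
Context {K : fieldType} {D : nat}.
Hypothesis charK0 : [pchar K] =i pred0.
Variable i0 : 'I_D.
Local Notation A := (free_alg K D).

Definition xgen (i : nat) : A := gen (insubd i0 i).

Lemma xgen_ord (i : 'I_D) : xgen i = gen i.
Proof. by rewrite /xgen valKd. Qed.

Definition is_opval (f : A) : Prop :=
  exists c l, size l = opdeg c /\ f = opval xgen (opword c l).

HB.instance Definition _ f := GRing.isLinear.Build K A A _ (lact f) (lact_linear (@malg_mulZr K D) f).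
HB.instance Definition _ f h :=
  GRing.isLinear.Build K A A _ (uact f h)
    (uact_linear (@malg_mulZr K D) f h).

Lemma lactC (f g : A) : lact f g = lact g f.
Proof. by rewrite /lact addrC. Qed.

Lemma span_lact_gen i f : spanned is_opval f -> spanned is_opval (lact (gen i) f).
Proof.
apply: span_linear => _ [c [l [szl ->]]]; apply: span_in.
exists (false :: c), (nat_of_ord i :: l); split; first by rewrite /= szl.
by rewrite -xgen_ord.
Qed.

Lemma span_uact_gen i j f :
  spanned is_opval f -> spanned is_opval (uact (gen i) (gen j) f).
Proof.
apply: span_linear => _ [c [l [szl ->]]]; apply: span_in.
exists (true :: c), [:: nat_of_ord i, nat_of_ord j & l]; split.
  by rewrite /= szl.
by rewrite -!xgen_ord.
Qed.

Fixpoint jval (t : jtree D) : A :=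
  match t with JLeaf i => gen i | JNode l r => lact (jval l) (jval r) end.

(** Induction on the degree of t. A monomial of degree at least 3 is (ab)c up to commutativity, and
    [lact_lact] rewrites multiplication by it through multiplications by monomials of lower degree.
    In degree 2, multiplication by x_i x_j is reduced to L_i, L_j and U_ij by [lact_uact]. *)
Lemma span_lact_jval t f :
  spanned is_opval f -> spanned is_opval (lact (jval t) f).
Proof.
have [k] := ubnP (jdeg t); elim: k t f => // k IH.
have stab a b c f : (jdeg a + jdeg b + jdeg c <= k)%N ->
    spanned is_opval f ->
    spanned is_opval (lact (lact (lact (jval a) (jval b)) (jval c)) f).
  move=> abc Sf; rewrite (lact_lact (@malg_mulZr K D)).
  have [[a0 b0] c0] := (jdeg_gt0 a, jdeg_gt0 b, jdeg_gt0 c).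
  rewrite -[lact (jval a) (jval b)]/(jval (JNode a b)).
  rewrite -[lact (jval a) (jval c)]/(jval (JNode a c)).
  rewrite -[lact (jval b) (jval c)]/(jval (JNode b c)).
  have [ab ac bc] : [/\ jdeg (JNode a b) < k, jdeg (JNode a c) < k
      & jdeg (JNode b c) < k]%N by split=> /=; lia.
  have [ka kb kc] : [/\ jdeg a < k, jdeg b < k & jdeg c < k]%N by split; lia.
  apply: span_add; [apply: span_add; [apply: span_add; [apply: span_add|]|]|].
  - by apply: (IH _ _ ab); apply: IH.
  - by apply: (IH _ _ bc); apply: IH.
  - by apply: (IH _ _ ac); apply: IH.
  - by apply: span_opp; apply: (IH _ _ ka); apply: (IH _ _ kc); apply: IH.
  - by apply: span_opp; apply: (IH _ _ kb); apply: (IH _ _ kc); apply: IH.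
case=> [i|l r] f szt Sf; first exact: span_lact_gen.
case: l szt => [i|a b] szt; last by apply: stab => //; rewrite -ltnS.
(* If only the right factor is composite, commutativity brings it to the front. *)
case: r szt => [j|a b] szt; last first.
  by rewrite /= [lact (gen i) _]lactC -[gen i]/(jval (JLeaf i)); apply: stab => //=;
    move: szt => /=; lia.
have -> : lact (jval (JNode (JLeaf i) (JLeaf j))) f
  = lact (gen i) (lact (gen j) f) + lact (gen j) (lact (gen i) f)
    - 2%:R *: uact (gen i) (gen j) f.
  by rewrite (lact_uact (@malg_mulZr K D)) opprB addrC subrK.
apply: span_add; first by apply: span_add; do 2!apply: span_lact_gen.
exact/span_opp/span_scale/span_uact_gen.
Qed.

Definition is_jval (f : A) : Prop := exists t, f = jval t.

Lemma span_jval f : SJ f -> spanned is_jval f.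
Proof.
elim=> [i||a g h _ Sg _ Sh|g h _ Sg _ Sh].
- by apply: span_in; exists (JLeaf i).
- exact: span_0.
- exact/span_add/Sh/span_scale.
apply: span_scale; rewrite -/(lact g h).
apply: (span_linear (h := lact g)) Sh => _ [t ->]; rewrite /= lactC.
apply: (span_linear (h := lact (jval t))) Sg => _ [u ->]; apply: span_in.
by exists (JNode t u).
Qed.

Lemma span_opval f : SJ f -> spanned is_opval f.
Proof.
move/span_jval; elim=> [|a _ g [t ->] _ Sg]; first exact: span_0.
apply: span_add => //; apply: span_scale; case: t => [i|l r] /=.
  apply: span_in; exists [::], [:: nat_of_ord i]; split=> //=.
  by rewrite /word big_seq1 xgen_ord.
apply: span_lact_jval; elim: r => [i|l' _ r' IH] /=.
  apply: span_in; exists [::], [:: nat_of_ord i]; split=> //=.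
  by rewrite /word big_seq1 xgen_ord.
exact: span_lact_jval.
Qed.

Lemma SJ_kill (V : lmodType K) (h : {linear A -> V}) f :
  (forall c l, size l = opdeg c -> h (opval xgen (opword c l)) = 0) ->
  SJ f -> h f = 0.
Proof.
move=> h0 /span_opval; elim=> [|a _ g [c [l [szl ->]]] _ IH].
  exact: linear0.
by rewrite linearP IH h0 // scaler0 addr0.
Qed.

End OperatorSpan.

Fixpoint mono_deg (m : seq nat) : nat :=
  match m with
  | 0 :: w => size w
  | 1 :: _ :: m' => (mono_deg m').+1
  | 2 :: _ :: _ :: m' => (mono_deg m').+2
  | 3 :: _ => 4
  | _ => 0
  end.

Fixpoint alt_core (m : seq nat) : bool :=
  match m with
  | 1 :: _ :: m' | 2 :: _ :: _ :: m' => alt_core m'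
  | 3 :: _ => true
  | _ => false
  end.

Lemma fbind_mem f E p :
  p \in fbind f E -> exists2 q, q \in E & exists2 r, r \in f q.2 & p.2 = r.2.
Proof.
case/flatten_mapP => q qE; rewrite /fscale => /mapP [r rf ->]; exists q => //.
by exists r.
Qed.

Lemma size_full m p : p \in full m -> size p.2 = mono_deg m.
Proof.
have [k] := ubnP (size m); elim: k m p => // k IH [|[|[|[|[|j]]]] m] p //= szm.
- by rewrite inE => /eqP->.
- case: m szm => [|i m] szm //= /fbind_mem[q qm [r rq ->]].
  have <- := IH _ _ (ltnW szm) qm.
  by move: rq; rewrite !inE => /orP[] /eqP-> //=; rewrite size_rcons.
- case: m szm => [|i [|j m]] szm //= /fbind_mem[q qm [r rq ->]].
  have <- := IH _ _ (ltnW (ltnW szm)) qm.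
  by move: rq; rewrite !inE => /orP[] /eqP-> /=; rewrite size_rcons.
- case: ifP => _; last by rewrite in_nil.
  case/mapP => q qa ->; case/mapP: qa => s.
  by rewrite mem_permutations => /perm_size sz -> /=; rewrite size_map sz.
Qed.

Lemma mono_deg_opword c l : size l = opdeg c -> mono_deg (opword c l) = opdeg c.
Proof.
elim: c l => [|[] c IH] l //= szl.
  by case: l szl => [|i [|j l]] //= [szl]; rewrite IH.
by case: l szl => [|i l] //= [szl]; rewrite IH.
Qed.

(** * Missing tetrads as the image of an idempotent *)

Section WordSpace.
Context {K : fieldType} {D n : nat}.
Variable i0 : 'I_D.
Local Notation A := (free_alg K D).
Local Notation I := (n.-tuple 'I_D).

Definition act (w : I) (s : seq nat) : I :=
  [tuple nth i0 w (nth 0%N s k) | k < n].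

Lemma val_act w s : size s = n -> act w s = map (nth i0 w) s :> seq _.
Proof.
move=> szs; apply: (@eq_from_nth _ i0); rewrite size_tuple ?size_map // => k kn.
by rewrite -(tnth_nth i0 _ (Ordinal kn)) tnth_mktuple (nth_map 0%N) // szs.
Qed.

Definition dword (w : I) : 'rV[K]_#|{: I}| := delta_mx 0 (enum_rank w).

(** Matrices act on row vectors from the right; E is read as an element of the group ring acting by
    permutation of places. *)
Definition opm (E : fsum) : 'M[K]_#|{: I}| :=
  \matrix_i evl (fun s => dword (act (enum_val i) s)) E.

Lemma dword_opm w E : dword w *m opm E = evl (fun s => dword (act w s)) E.
Proof. by rewrite -rowE rowK enum_rankK. Qed.

Lemma row_sum_dword (v : 'rV[K]_#|{: I}|) :
  v = \sum_(w : I) v 0 (enum_rank w) *: dword w.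
Proof.
rewrite {1}[v]row_sum_delta (reindex_onto enum_rank enum_val) => [|i _].
  by apply: eq_bigl => w; rewrite enum_rankK eqxx.
by rewrite enum_valK.
Qed.

Definition fword (w : seq 'I_D) : A := << FMonom w >>.

Definition tofree (v : 'rV[K]_#|{: I}|) : A :=
  \sum_(w : I) v 0 (enum_rank w) *: fword w.

Definition ofree (f : A) : 'rV[K]_#|{: I}| := \row_i f@_(FMonom (enum_val i : I)).

Lemma tofree_linear : linear tofree.
Proof.
move=> a u v; rewrite /tofree scaler_sumr -big_split; apply: eq_bigr => w _ /=.
by rewrite !mxE scalerDl scalerA.
Qed.
HB.instance Definition _ :=
  GRing.isLinear.Build K _ A _ tofree tofree_linear.

Lemma ofree_linear : linear ofree.
Proof. by move=> a f g; apply/rowP => i; rewrite !mxE mcoeffD mcoeffZ. Qed.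
HB.instance Definition _ := GRing.isLinear.Build K A _ _ ofree ofree_linear.

Lemma ofree_fword (w : I) : ofree (fword w) = dword w.
Proof.
apply/rowP => i; rewrite !mxE /fword mcoeffU1 eqxx /=; congr (_ %:R).
rewrite fmP /= -(inj_eq enum_val_inj) enum_rankK eq_sym.
by rewrite -val_eqE.
Qed.

Lemma ofree_fword0 (w : seq 'I_D) : size w <> n -> ofree (fword w) = 0.
Proof.
move=> szw; apply/rowP => i; rewrite !mxE mcoeffU1; case: eqP => // wi.
case: szw; have <- := size_tuple (enum_val i : I).
by have /(congr1 (@fmonom_val _)) /= -> := wi.
Qed.

Lemma tofree_dword w : tofree (dword w) = fword w.
Proof.
rewrite /tofree (bigD1 w) //= big1 ?addr0; last first.
  by move=> v vw; rewrite mxE (inj_eq enum_rank_inj) (negPf vw) scale0r.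
by rewrite mxE !eqxx scale1r.
Qed.

Lemma tofreeK : cancel tofree ofree.
Proof.
move=> v; rewrite [RHS]row_sum_dword linear_sum; apply: eq_bigr => w _.
by rewrite linearZ /= ofree_fword.
Qed.

Lemma homog_tofree v : homog n (tofree v).
Proof.
move=> w; rewrite -mcoeff_neq0; apply: contraTeq => szw.
rewrite negbK /tofree raddf_sum big1 // => u _ /=; rewrite mcoeffZ mcoeffU1.
case: eqP => [uw|]; last by rewrite mulr0.
by move: szw; rewrite -uw /fdeg size_tuple eqxx.
Qed.

Lemma ofreeK f : homog n f -> tofree (ofree f) = f.
Proof.
move=> hf; apply/malgP => u; rewrite /tofree raddf_sum /=.
have [uf|] := boolP (u \in msupp f); last first.
  move=> uf; rewrite mcoeff_outdom // big1 // => w _.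
  rewrite mcoeffZ mxE enum_rankK mcoeffU1; case: eqP => [->|]; rewrite ?mulr0 //.
  by rewrite mcoeff_outdom // mul0r.
have szu : size u == n by apply/eqP/hf.
rewrite (bigD1 (Tuple szu)) //= big1 ?addr0; last first.
  move=> w wu; rewrite mcoeffZ mcoeffU1; case: eqP => [e|]; rewrite ?mulr0 //.
  by case/eqP: wu; apply: val_inj; rewrite /= -e.
rewrite mcoeffZ mxE enum_rankK mcoeffU1.
have -> : FMonom (Tuple szu) = u by apply/eqP; rewrite fmP.
by rewrite eqxx mulr1.
Qed.

Definition xword (w : I) (k : nat) : A := gen (nth i0 w k).

Lemma word_gen (y : nat -> 'I_D) s :
  word (fun k => gen (y k) : A) s = fword (map y s).
Proof.
elim: s => [|k s IH]; rewrite ?word_cons ?IH /fword /=.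
  rewrite /word big_nil; apply/malgP => v; rewrite mcoeff1 mcoeffU1.
  have -> : FMonom [::] = mone :> {fmonom 'I_D} by apply/eqP; rewrite fmP /= fm1.
  by rewrite eq_sym.
rewrite /gen; set u := fmu _; set v := FMonom _.
have -> : << u >> * << v >> = << 1 * 1 *g mmul u v >> :> A by exact: fgmulUU.
rewrite mulr1; congr << _ >>; apply/eqP; rewrite fmP fmM /=.
by rewrite /u fmU.
Qed.

Lemma word_act w s : size s = n -> word (xword w) s = fword (act w s).
Proof. by move=> szs; rewrite word_gen val_act. Qed.

End WordSpace.

Section AntiMorphism.
Context {K : fieldType} {A : lalgType K}.
Variable s : {linear A -> A}.
Hypothesis sM : forall f g, s (f * g) = s g * s f.
Hypothesis s1 : s 1 = 1.
Implicit Type x : nat -> A.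

Lemma anti_word x w : (forall i, s (x i) = x i) -> s (word x w) = word x (rev w).
Proof.
move=> sx; elim: w => [|i w IH]; first by rewrite /word big_nil.
by rewrite rev_cons word_cons word_rcons sM IH sx.
Qed.

(** Reversing four letters is an even permutation; this is why T is fixed by the anti-involution. *)
Lemma alt4_rev (F : seq nat -> A) :
  evl F (fmap_words (fun w => map (nth 0%N w) [:: 3; 2; 1; 0]%N) alt4) = evl F alt4.
Proof. by apply: fnorm_sub; vm_compute. Qed.

Lemma anti_val x m : (forall i, s (x i) = x i) ->
  alt_core m -> s (opval x m) = opval x m.
Proof.
move=> sx; have [k] := ubnP (size m); elim: k m => // k IH [|[|[|[|[|j]]]] m] //= szm.
- case: m szm => [|i m] // szm am; rewrite linearD !sM !sx IH 1?addrC //.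
  exact: ltnW.
- case: m szm => [|i [|j m]] // szm am; rewrite linearD !sM !sx IH //.
    by rewrite addrC !mulrA.
  exact/ltnW/ltnW.
move=> _; case: eqP => sz4; last exact: linear0.
rewrite evl_linear evl_fmap -alt4_rev !evl_fmap.
apply: eq_evl_in => p p_alt4 /=; rewrite anti_word //; congr word.
case/mapP: p_alt4 => t; rewrite mem_permutations => /perm_size sz -> /=.
by case: t sz => [|a [|b [|c [|d [|e t]]]]].
Qed.

End AntiMorphism.

Section SigmaVal.
Context {K : fieldType} {D : nat}.
Local Notation A := (free_alg K D).

Lemma sigma_linear : linear (sigma : A -> A).
Proof. by move=> a f g; rewrite sigma_lin. Qed.
HB.instance Definition _ := GRing.isLinear.Build K A A _ sigma sigma_linear.

Lemma sigma1 : sigma (1 : A) = 1.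
Proof.
apply/malgP => v; rewrite mcoeff_sigma !mcoeff1.
rewrite -[v == _](inj_eq (can_inj (@rev_wordK D))).
have -> : rev_word mone = mone :> {fmonom 'I_D} by apply/eqP; rewrite fmP /= fm1.
by [].
Qed.

Lemma sigma_val (x : nat -> A) m : (forall i, sigma (x i) = x i) ->
  alt_core m -> sigma (opval x m) = opval x m.
Proof. exact: (anti_val (s := sigma) (@sigmaM K D) sigma1). Qed.

End SigmaVal.

Lemma scale_rel (K : fieldType) (V : lmodType K) (z : K) (f g : V) : z != 0 ->
  (2%:R * z)^-1 *: (z *: f + zr (Zneg xH) *: g)
  = 2^-1 *: f - (2%:R * z)^-1 *: g.
Proof.
move=> z0; rewrite scalerDr !scalerA -[zr (Zneg xH)]/(-1) mulrN1 scaleNr invfM.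
by rewrite -mulrA mulVf // mulr1.
Qed.

Section Quotient.
Context {K : fieldType} {D n : nat}.
Hypothesis charK0 : [pchar K] =i pred0.
Hypothesis n_gt0 : (0 < n)%N.
Variable i0 : 'I_D.
Variables (q : fsum) (N : Z).
Hypothesis N_neq0 : zr N != 0 :> K.
Hypothesis q_rel : in_SJ (K := K) (fscale N (pal (iota 0 n)) ++ fscale (Zneg xH) q).
Hypothesis q_deg : all (fun p => mono_deg p.2 == n) q.
Hypothesis q_core : all (fun p => alt_core p.2) q.
Hypothesis q_lett : frelab (iota 0 n) q = q.
Hypothesis q_sym : fnf (frelab (rev (iota 0 n)) q ++ fscale (Zneg xH) q) = [::].
Hypothesis q_kill : forall c, opdeg c = n ->
  fnf (fbind (fun s => frelab s q) (full (opword c (iota 0 n)))) = [::].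

Local Notation A := (free_alg K D).
Local Notation I := (n.-tuple 'I_D).
Local Notation xword := (@xword K D n i0).
Local Notation dword := (@dword K D n).
Local Notation tofree := (@tofree K D n).
Local Notation ofree := (@ofree K D n).
Local Notation mulZ := (@malg_mulZr K D).

(** The additional factor 2 appears because {w} / 2, and not {w}, is the symmetrization of w. *)
Definition projmx : 'M[K]_#|{: I}| := (2%:R * zr N)^-1 *: opm i0 (fbind full q).

Lemma size_fullq p : p \in fbind full q -> size p.2 = n.
Proof.
case/fbind_mem => r rq [s /size_full szs ->]; rewrite szs.
by move/allP: q_deg => /(_ _ rq) /eqP.
Qed.

Lemma tofree_projmx w :
  tofree (dword w *m projmx) = (2%:R * zr N)^-1 *: evl (opval (xword w)) q.
Proof.
rewrite -scalemxAr linearZ /=; congr (_ *: _).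
rewrite dword_opm evl_linear -(evl_bind _ (val_full mulZ (xword w))).
apply: eq_evl_in => p /size_fullq szp /=.
by rewrite tofree_dword word_act.
Qed.

#[local] Opaque projmx.

(** By [q_lett], relabelling by [iota 0 n] fixes q. This relabelling reads only letters below n,
    since it sends larger ones to the default 0. *)
Lemma evl_q x y : (forall k, (k < n)%N -> x k = y k) ->
  evl (opval x) q = evl (opval y) q :> A.
Proof.
move=> xy; rewrite -q_lett !evl_relab; apply: eq_evl => m; apply: val_ext => k /=.
have [kn|kn] := ltnP k n; first by rewrite nth_iota // xy.
by rewrite nth_default ?size_iota // xy.
Qed.

Lemma evl_q_act (w : I) s :
  evl (opval (xword (act i0 w s))) q = evl (opval (xword w)) (frelab s q).
Proof.
rewrite evl_relab; apply: evl_q => k kn /=.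
by rewrite /xword -(tnth_nth i0 _ (Ordinal kn)) tnth_mktuple.
Qed.

Lemma tofree_act w s :
  tofree (dword (act i0 w s) *m projmx)
  = (2%:R * zr N)^-1 *: evl (opval (xword w)) (frelab s q).
Proof. by rewrite tofree_projmx evl_q_act. Qed.

(** It suffices to treat operator words. Those of degree other than n have no component of degree n;
    one of degree n is a relabelling of a multilinear word, for which [q_kill] is the required
    formal identity. *)
Lemma projmx_kill f : SJ f -> ofree f *m projmx = 0.
Proof.
pose h f := ofree f *m projmx.
have h_lin : linear h.
  by move=> a f1 f2; rewrite /h linearP mulmxDl scalemxAl.
pose hL := GRing.isLinear.Build K A _ _ h h_lin.
pose H : {linear A -> 'rV[K]_#|{: I}|} := HB.pack h hL.
rewrite -[LHS]/(H f); apply: (SJ_kill (i0 := i0) (h := H)) => c l szl.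
have [nc|nc] := eqVneq (opdeg c) n; last first.
  rewrite -(val_full mulZ) evl_linear; apply: evl_zero => p /size_full szp.
  rewrite /= /h (word_gen (insubd i0)) ofree_fword0 ?mul0mx //.
  by rewrite size_map szp mono_deg_opword //; apply/eqP.
have szl' : size l == n by rewrite szl nc.
have szl2 : size (map (insubd i0) l) == n by rewrite size_map.
pose w : I := Tuple szl2.
have -> : opword c l = relab l (opword c (iota 0 n)).
  rewrite relab_opword ?size_iota //; congr opword.
  by rewrite -(eqP szl') map_nth_iota0 // take_size.
pose m := opword c (iota 0 n).
have iota_id : map (nth 0%N (iota 0 n)) (iota 0 n) = iota 0 n.
  by rewrite map_nth_iota0 ?take_oversize ?size_iota.
have m_iota : relab (iota 0 n) m = m by rewrite relab_opword ?size_iota ?iota_id.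
rewrite val_relab -/m.
(* The two substitutions agree on the letters below n, and m contains no others. *)
have -> : opval (xgen i0 \o nth 0%N l) m = opval (xword w) m :> A.
  rewrite -m_iota !val_relab; apply: val_ext => k /=.
  set j := nth _ _ k; have jn : (j < n)%N.
    rewrite /j; have [kn|kn] := ltnP k n; first by rewrite nth_iota.
    by rewrite nth_default ?size_iota.
  by rewrite /xgen /xword (nth_map 0%N) // (eqP szl').
rewrite -(val_full mulZ) evl_linear -[evl _ _](@tofreeK K D n).
rewrite -[RHS](@linear0 _ _ _ _ ofree); congr ofree; rewrite evl_linear.
rewrite (eq_evl_in (G := fun s => (2%:R * zr N)^-1 *: evl (opval (xword w)) (frelab s q)));
  last first.
  move=> p /size_full szp; rewrite -tofree_act /= /h word_act ?ofree_fword //.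
  by rewrite szp mono_deg_opword ?size_iota.
set F := fun s => _; rewrite [LHS](_ : _ = (2%:R * zr N)^-1 *:
  evl (fun s => evl (opval (xword w)) (frelab s q)) (full m)); last first.
  by rewrite /evl scaler_sumr; apply: eq_bigr => p _; rewrite scalerA mulrC -scalerA.
rewrite -(evl_bind _ (fun=> erefl)) -(val_nf mulZ) ?two_neq0 // q_kill //.
by rewrite evl_nil scaler0.
Qed.

Lemma SJ_xword w i : SJ (xword w i).
Proof. exact: SJ_gen. Qed.

Lemma map_nth_tuple (w : I) : map (nth i0 w) (iota 0 n) = w.
Proof. by rewrite map_nth_iota0 ?take_oversize ?size_tuple. Qed.

Lemma evl_pal_xword (w : I) :
  evl (opval (xword w)) (pal (iota 0 n)) = fword w + fword (rev w) :> A.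
Proof.
rewrite evl_pal (word_gen _ (iota 0 n)) (word_gen _ (rev (iota 0 n))).
by rewrite map_rev map_nth_tuple.
Qed.

Lemma proj_rel (w : I) :
  SJ (2^-1 *: (fword w + fword (rev w) : A) - tofree (dword w *m projmx)).
Proof.
have SJw := q_rel (SJ_xword w).
have {SJw} := SJ_scale (2%:R * zr N)^-1 SJw; rewrite evl_cat !evl_scale.
by rewrite tofree_projmx evl_pal_xword scale_rel.
Qed.

Lemma proj_sym (w : I) : dword (rev_tuple w) *m projmx = dword w *m projmx.
Proof.
apply: (can_inj (@tofreeK K D n)); rewrite (tofree_projmx w).
have -> : evl (opval (xword w)) q = evl (opval (xword w)) (frelab (rev (iota 0 n)) q).
  have /(congr1 (evl (opval (xword w)))) := q_sym.
  rewrite (val_nf mulZ) ?two_neq0 // evl_nil evl_cat evl_scale scaleN1r.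
  by move/eqP; rewrite subr_eq0 => /eqP.
have -> : rev_tuple w = act i0 w (rev (iota 0 n)).
  apply: val_inj; rewrite [RHS]val_act ?size_rev ?size_iota //.
  by rewrite map_rev map_nth_tuple.
exact: tofree_act.
Qed.

(** The element {w} / 2 - Pw of SJ is killed by P. Since P takes the same value on w and on its
    reversal, what remains is Pw = PPw. *)
Lemma proj_idem : projmx *m projmx = projmx.
Proof.
apply/row_matrixP => i; rewrite !rowE -[i]enum_valK -/(dword _) mulmxA.
set w : I := enum_val i.
have E T : ofree (2^-1 *: (fword w + fword (rev w)) - tofree T)
    = 2^-1 *: (dword w + dword (rev_tuple w)) - T.
  rewrite linearB linearZ linearD /= tofreeK.
  by rewrite (ofree_fword w) (ofree_fword (rev_tuple w)).
have := projmx_kill (proj_rel w); rewrite E mulmxBl -scalemxAl mulmxDl proj_sym.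
rewrite -mulr2n -scaler_nat scalerA mulVf ?two_neq0 // scale1r.
by move/eqP; rewrite subr_eq0 => /eqP.
Qed.

Lemma tofree_proj_sum (v : 'rV[K]_#|{: I}|) :
  tofree (v *m projmx)
  = \sum_(w : I) v 0 (enum_rank w) *: tofree (dword w *m projmx).
Proof.
rewrite {1}[v]row_sum_dword mulmx_suml linear_sum; apply: eq_bigr => w _.
by rewrite -scalemxAl linearZ.
Qed.

Lemma CJ_tofree_proj (v : 'rV[K]_#|{: I}|) : CJ (tofree (v *m projmx)).
Proof.
have hom := @homog_tofree K D n (v *m projmx); split.
  rewrite /in_T; apply/mcoeff_outdom/negP => /hom.
  by rewrite /fdeg fm1 => n0; move: n_gt0; rewrite -n0.
rewrite tofree_proj_sum linear_sum; apply: eq_bigr => w _.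
rewrite linearZ /= tofree_projmx; congr (_ *: _).
set g := evl _ q; suff g_sym : sigma g = g by rewrite linearZ /= g_sym.
rewrite /g evl_linear; apply: eq_evl_in => p pq /=.
apply: sigma_val => [i|]; first exact: sigma_gen.
by move/allP: q_core => /(_ _ pq).
Qed.

Lemma CJ_proj (u : A) : CJ u -> homog n u -> SJ (u - tofree (ofree u *m projmx)).
Proof.
case=> _ su hu; set v := ofree u.
pose r (w : I) : A := 2^-1 *: (fword w + fword (rev w)) - tofree (dword w *m projmx).
(* A symmetric element is the mean of itself and its image under [sigma]. *)
have u_sum : u = \sum_(w : I) v 0 (enum_rank w) *:
    (2^-1 *: (fword w + fword (rev w))).
  have {1}-> : u = 2^-1 *: (u + sigma u).
    by rewrite su -mulr2n -scaler_nat scalerA mulVf ?two_neq0 // scale1r.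
  rewrite -(ofreeK hu) -/v {1 2}/tofree linear_sum -big_split scaler_sumr.
  apply: eq_bigr => w _; rewrite linearZ /= -scalerDr scalerA mulrC -scalerA.
  congr (_ *: (_ *: (_ + _))); rewrite /fword sigmaU.
  by congr << _ >>; apply/eqP; rewrite fmP.
have -> : u - tofree (v *m projmx) = \sum_w v 0 (enum_rank w) *: r w.
  rewrite tofree_proj_sum {1}u_sum -sumrB; apply: eq_bigr => w _.
  by rewrite -scalerBr.
elim/big_rec: _ => [|w f _ IH]; first exact: SJ_0.
by apply: SJ_add => //; apply/SJ_scale/proj_rel.
Qed.

(** Existence of coordinates is [CJ_proj]. For uniqueness, P kills SJ and fixes the basis B of its
    row space, so that the coordinates can be read off from the image of u under P. *)
Lemma dim_quot_proj : dim_missing_tetrads K D n (\rank projmx).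
Proof.
set B := row_base projmx.
have BP : B *m projmx = B.
  have /submxP[C ->] : (B <= projmx)%MS by rewrite eq_row_base.
  by rewrite -mulmxA proj_idem.
exists (fun i => tofree (row i B)); split=> [i|u [Cu hu]].
  rewrite rowE -BP mulmxA; split; first exact: CJ_tofree_proj.
  exact: homog_tofree.
have sum_tofree (c : 'rV[K]_(\rank projmx)) :
    \sum_i c 0 i *: tofree (row i B) = tofree (c *m B).
  by rewrite mulmx_sum_row linear_sum; apply: eq_bigr => i _; rewrite linearZ.
exists (ofree u *m projmx *m pinvmx B); split.
  rewrite sum_tofree mulmxKpV ?eq_row_base ?submxMl //.
  exact: CJ_proj.
move=> c; rewrite sum_tofree => /projmx_kill.
rewrite linearB /= tofreeK mulmxBl -(mulmxA c B) BP => /eqP.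
rewrite subr_eq0 => /eqP->.
by rewrite mulmxKp ?row_base_free.
Qed.

End Quotient.

(** * Ranks of idempotents and cycles of place permutations *)

Lemma rank_idempotent (K : fieldType) d (P : 'M[K]_d) :
  P *m P = P -> (\rank P)%:R = \tr P.
Proof.
move=> PP; pose R := row_base P; pose C := col_base P.
(* For a full rank factorisation P = CR, PP = P reads CRCR = CR, and cancelling R on the right and C
   on the left gives RC = 1. *)
have RC1 : R *m C = 1%:M.
  have CR : C *m R = P by exact: mulmx_base.
  have E : C *m (R *m C) *m R = C *m R by rewrite mulmxA CR -mulmxA CR PP.
  move/(congr1 (mulmxr (pinvmx R))): E; rewrite /= !mulmxKp ?row_base_free // => E.
  by rewrite -[LHS]mul1mx -(mulVpmx (col_base_full P)) -mulmxA E mulVpmx ?col_base_full.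
by rewrite -{2}(mulmx_base P) mxtrace_mulC RC1 mxtrace1.
Qed.

Definition orbit_min (s : seq nat) (i : nat) : nat :=
  foldr minn i (traject (nth 0%N s) i (size s)).

Definition orbit_mins (s : seq nat) : seq nat := mkseq (orbit_min s) (size s).

(* The conditions under which the entries of [orbit_mins s] index the orbits *)
(* of s.                                                                     *)
Definition orbit_ok (s : seq nat) : bool :=
  let r := orbit_mins s in
  all (fun i => [&& nth 0 s i < size s, nth 0 r i <= i,
    nth 0 r (nth 0 s i) == nth 0 r i & nth 0 r (nth 0 r i) == nth 0 r i])%N
    (iota 0 (size s)).

Definition orbit_count (s : seq nat) : nat :=
  let r := orbit_mins s in count (fun i => nth 0 r i == i)%N (iota 0 (size s)).

Fixpoint coef_add (k : nat) (z : Z) (l : seq Z) : seq Z :=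
  match k, l with
  | 0, [::] => [:: z]
  | 0, y :: l' => Z.add z y :: l'
  | k'.+1, [::] => Z0 :: coef_add k' z [::]
  | k'.+1, y :: l' => y :: coef_add k' z l'
  end.

Definition trace_poly (E : fsum) : seq Z :=
  foldr (fun p l => coef_add (orbit_count p.2) p.1 l) [::] E.

Section Trace.
Context {K : fieldType} {D n : nat}.
Variable i0 : 'I_D.
Local Notation I := (n.-tuple 'I_D).

(** A word is fixed exactly when it is constant on the cycles of s. The least elements of the cycles
    represent them, so fixed words correspond to functions on these representatives. *)
Lemma card_fixed s : size s = n -> orbit_ok s ->
  #|[set w : I | act i0 w s == w]| = (D ^ orbit_count s)%N.
Proof.
move=> szs /allP ok; pose r k := nth 0%N (orbit_mins s) k.
have okP k : (k < n)%N -> [/\ nth 0 s k < n, r k <= k, r (nth 0 s k) = r k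
    & r (r k) = r k]%N.
  move=> kn; have /ok : k \in iota 0 (size s) by rewrite mem_iota szs.
  by rewrite szs => /and4P[? ? /eqP ? /eqP ?].
have rn k : (k < n)%N -> (r k < n)%N.
  by move=> kn; have [_ rk _ _] := okP k kn; apply: leq_ltn_trans kn.
pose T := {k : 'I_n | r k == k}.
have rho_proof (k : 'I_n) : r (Ordinal (rn k (ltn_ord k))) == Ordinal (rn k (ltn_ord k)).
  by apply/eqP; case: (okP k (ltn_ord k)).
pose rho (k : 'I_n) : T := Sub (Ordinal (rn k (ltn_ord k))) (rho_proof k).
pose W (h : {ffun T -> 'I_D}) : I := [tuple h (rho k) | k < n].
have rho_val (t : T) : rho (val t) = t.
  by apply: val_inj; apply: val_inj; rewrite /=; apply/eqP/(valP t).
have W_inj : injective W.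
  move=> h h' /(congr1 (fun w => tnth w)) hh'; apply/ffunP => t.
  by have := congr1 (fun f => f (val t)) hh'; rewrite !tnth_mktuple rho_val.
have nthE (w : I) k (kn : (k < n)%N) : nth i0 w k = tnth w (Ordinal kn).
  by rewrite (tnth_nth i0).
have -> : [set w : I | act i0 w s == w] = W @: [set: {ffun T -> 'I_D}].
  apply/setP => w; rewrite inE; apply/eqP/imsetP => [ws|[h _ ->]]; last first.
    apply: eq_from_tnth => k; rewrite tnth_mktuple.
    have [sk rk rs rr] := okP k (ltn_ord k).
    rewrite (nthE _ _ sk) /W !tnth_mktuple; congr (h _).
    by apply: val_inj; apply: val_inj.
  have step k : (k < n)%N -> nth i0 w (nth 0%N s k) = nth i0 w k.
    by move=> kn; rewrite -{2}ws (nthE (act i0 w s) _ kn) tnth_mktuple.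
  have orbit j k : (k < n)%N ->
      (iter j (nth 0%N s) k < n)%N /\ nth i0 w (iter j (nth 0%N s) k) = nth i0 w k.
    move=> kn; elim: j => //= j [jn jw].
    by have [sk _ _ _] := okP _ jn; rewrite step.
  have rw k : (k < n)%N -> nth i0 w (r k) = nth i0 w k.
    move=> kn; rewrite /r nth_mkseq ?szs // /orbit_min.
    have : forall l, {subset l <= traject (nth 0%N s) k (size s)} ->
        nth i0 w (foldr minn k l) = nth i0 w k.
      elim=> //= a l IH sub; rewrite {1}/minn; case: ifP => _; last first.
        by apply: IH => x xl; apply: sub; rewrite in_cons xl orbT.
      have /trajectP[j _ ->] := sub a (mem_head _ _).
      by case: (orbit j k kn).
    by apply.
  exists [ffun t : T => tnth w (val t)] => //.
  apply: eq_from_tnth => k; rewrite tnth_mktuple ffunE /=.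
  by rewrite !(tnth_nth i0) /= rw.
rewrite card_imset // cardsT card_ffun card_ord; congr (_ ^ _)%N.
rewrite card_sub /orbit_count szs -val_enum_ord count_map.
by rewrite cardE {1}/enum_mem size_filter enumT; apply: eq_count.
Qed.

Lemma trace_opm E : all (fun p => (size p.2 == n) && orbit_ok p.2) E ->
  \tr (opm i0 E : 'M[K]_#|{: I}|) = \sum_(k < size (trace_poly E))
     zr (nth Z0 (trace_poly E) k) * D%:R ^+ k.
Proof.
move=> ok.
have -> : \tr (opm i0 E : 'M[K]_#|{: I}|)
    = \sum_(p <- E) zr p.1 * D%:R ^+ orbit_count p.2.
  rewrite /mxtrace.
  under eq_bigr => i _ do rewrite mxE /evl summxE.
  rewrite exchange_big big_seq [RHS]big_seq; apply: eq_bigr => p pE.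
  under eq_bigr => i _ do rewrite mxE.
  rewrite -mulr_sumr; congr (_ * _).
  have /andP[/eqP szp okp] := allP ok _ pE.
  rewrite -natrX -(card_fixed szp okp) -sum1_card natr_sum.
  rewrite [RHS]big_mkcond (reindex_onto enum_rank enum_val) => [|i _].
    apply: eq_big => [w|w _]; first by rewrite enum_rankK eqxx.
    rewrite !mxE enum_rankK inE eqxx /= (inj_eq enum_rank_inj) eq_sym.
    by case: eqP.
  by rewrite enum_valK.
pose S (l : seq Z) := \sum_(k < size l) zr (nth Z0 l k) * D%:R ^+ k : K.
have S_cons y l : S (y :: l) = zr y + D%:R * S l.
  rewrite /S /= big_ord_recl mulr1 mulr_sumr; congr (_ + _).
  by apply: eq_bigr => k _; rewrite exprS mulrCA.
have S_nil : S [::] = 0 by exact: big_ord0.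
rewrite -/(S _); elim: E {ok} => [|p E IH]; first by rewrite big_nil S_nil.
rewrite big_cons IH /=; move: (trace_poly E) (orbit_count p.2) p.1 => l k z {IH}.
elim: k l => [|k IH] [|y l] /=; rewrite ?S_cons ?S_nil.
- by rewrite mulr1 mulr0.
- by rewrite zrD mulr1 addrA.
- by rewrite -IH S_nil !addr0 exprS mulrCA zr0 add0r.
- by rewrite -IH mulrDr addrCA exprS mulrCA.
Qed.

End Trace.

Fixpoint opcodes (n : nat) : seq (seq bool) :=
  if n is m.+1 then
    (if m is k.+1 then [seq true :: c | c <- opcodes k] else [:: [::]])
      ++ [seq false :: c | c <- opcodes m]
  else [::].

Lemma mem_opcodes c : c \in opcodes (opdeg c).
Proof.
have gt0 c' : (0 < opdeg c')%N by case: c'.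
elim: c => [|[] c IH] //=; rewrite mem_cat.
  by rewrite map_f.
by rewrite map_f ?orbT.
Qed.

(** The decidable hypotheses on q under which q / 2N is the projection onto the missing tetrads. The
    last clause says that r is N {w} - q formally. *)
Definition splits (n : nat) (N : Z) (r : fsum) : bool :=
  let q := quo r in
  [&& all (fun p => mono_deg p.2 == n) q, all (fun p => alt_core p.2) q,
      frelab (iota 0 n) q == q,
      fnf (frelab (rev (iota 0 n)) q ++ fscale (Zneg xH) q) == [::],
      all (fun c => fnf (fbind (fun s => frelab s q)
                           (full (opword c (iota 0 n)))) == [::]) (opcodes n) &
      fnorm ((fscale N (pal (iota 0 n)) ++ fscale (Zneg xH) q)
             ++ fscale (Zneg xH) r) == [::]].

(** The multiples of {w} are 12 from [rel4], 24 = 2 * 12 by rotation, 192 from [cert6], and 3538944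
    = 2 * 192 * 9216 by rotation and the scaling in [rel7]. *)
Lemma splits4 : splits 4 12 rel4. Proof. by vm_compute. Qed.
Lemma splits5 : splits 5 24 rel5. Proof. by vm_compute. Qed.
Lemma splits6 : splits 6 192 rel6. Proof. by vm_compute. Qed.
Lemma splits7 : splits 7 3538944 rel7. Proof. by vm_compute. Qed.

Definition trace_ok (n : nat) (E : fsum) : bool :=
  all (fun p => (size p.2 == n) && orbit_ok p.2) E.

(** * Polarization of tensor powers *)

Section TensorPower.
Context {K : fieldType} {D n : nat}.
Variable i0 : 'I_D.
Local Notation I := (n.-tuple 'I_D).
Local Notation act := (@act D n i0).
Local Notation dword := (@dword K D n).
Local Notation opm := (@opm K D n i0).
Implicit Types (g h : 'M[K]_D) (s : seq nat).

Lemma prod_tuple_distr (F : 'I_n -> 'I_D -> K) :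
  \sum_(w : I) \prod_k F k (tnth w k) = \prod_k \sum_j F k j.
Proof.
rewrite bigA_distr_bigA /= (reindex (fun f : {ffun 'I_n -> 'I_D} => [tuple f k | k < n])).
  by apply: eq_bigr => f _; apply: eq_bigr => k _; rewrite tnth_mktuple.
exists (fun w : I => [ffun k => tnth w k]) => [f|w] _.
  by apply/ffunP => k; rewrite ffunE tnth_mktuple.
by apply: eq_from_tnth => k; rewrite tnth_mktuple ffunE.
Qed.

(* The transpose of the n-th tensor power of g. *)
Definition tpow g : 'M[K]_#|{: I}| :=
  \matrix_(i, j) \prod_k g (tnth (enum_val j) k) (tnth (enum_val i) k).

Lemma tpowE g (w w' : I) :
  tpow g (enum_rank w) (enum_rank w') = \prod_k g (tnth w' k) (tnth w k).
Proof. by rewrite mxE !enum_rankK. Qed.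

Lemma tuple_matrixP (M N : 'M[K]_#|{: I}|) :
  (forall w w' : I, M (enum_rank w) (enum_rank w') = N (enum_rank w) (enum_rank w')) ->
  M = N.
Proof.
by move=> MN; apply/matrixP => i j; rewrite -[i]enum_valK -[j]enum_valK.
Qed.

Lemma sum_tuple_ord (F : 'I_#|{: I}| -> K) : \sum_i F i = \sum_(w : I) F (enum_rank w).
Proof.
by rewrite (reindex_onto enum_rank enum_val) => [|i _]; rewrite ?enum_valK //;
  apply: eq_bigl => w; rewrite enum_rankK eqxx.
Qed.

Lemma tpow1 : tpow 1%:M = 1%:M.
Proof.
apply: tuple_matrixP => w w'; rewrite tpowE mxE (inj_eq enum_rank_inj).
have [->|ww'] := eqVneq w w'.
  by rewrite big1 // => k _; rewrite mxE eqxx.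
have [k wk] : exists k, tnth w k != tnth w' k.
  apply/existsP; rewrite -negb_forall; apply: contra ww' => /forallP e.
  by apply/eqP/eq_from_tnth => k; apply/eqP/e.
by rewrite (bigD1 k) //= mxE eq_sym (negPf wk) mul0r.
Qed.

Lemma tpowM g h : tpow (g *m h) = tpow h *m tpow g.
Proof.
apply: tuple_matrixP => w w'; rewrite tpowE mxE sum_tuple_ord.
rewrite (eq_bigr (fun v : I => \prod_k (g (tnth w' k) (tnth v k) * h (tnth v k) (tnth w k)))).
  rewrite (prod_tuple_distr (fun k j => g (tnth w' k) j * h j (tnth w k))).
  by apply: eq_bigr => k _; rewrite mxE.
by move=> v _; rewrite !tpowE -big_split; apply: eq_bigr => k _; rewrite mulrC.
Qed.

Definition perm_word (s : seq nat) := perm_eq s (iota 0 n).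

Lemma size_perm_word s : perm_word s -> size s = n.
Proof. by move/perm_size; rewrite size_iota. Qed.

Lemma perm_word_lt s k : perm_word s -> (k < n)%N -> (nth 0 s k < n)%N.
Proof.
move=> ps kn; have := mem_nth 0%N (s := s) (n := k); rewrite (size_perm_word ps) => /(_ kn).
by rewrite (perm_mem ps) mem_iota.
Qed.

Definition seq_perm s (ps : perm_word s) (k : 'I_n) : 'I_n :=
  Ordinal (perm_word_lt ps (ltn_ord k)).

Lemma seq_perm_inj s (ps : perm_word s) : injective (seq_perm ps).
Proof.
move=> j k /(congr1 val) /= /eqP.
rewrite nth_uniq ?(size_perm_word ps) // ?(perm_uniq ps) ?iota_uniq // => /eqP jk.
exact: val_inj.
Qed.

Lemma tnth_act (w : I) s (ps : perm_word s) k :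
  tnth (act w s) k = tnth w (seq_perm ps k).
Proof. by rewrite tnth_mktuple (tnth_nth i0). Qed.

Lemma act_inj s : perm_word s -> injective (act^~ s).
Proof.
move=> ps w w' ww'; apply: eq_from_tnth => k.
have [f fK Kf] := injF_bij (@seq_perm_inj s ps).
by rewrite -[k]Kf -!tnth_act ww'.
Qed.

Definition perm_sum (E : fsum) := all (fun p => perm_word p.2) E.

Lemma dword_mul w (M : 'M[K]_#|{: I}|) :
  dword w *m M = \sum_(w' : I) M (enum_rank w) (enum_rank w') *: dword w'.
Proof.
rewrite [LHS]row_sum_dword; apply: eq_bigr => w' _.
by rewrite -rowE mxE.
Qed.

Lemma dword_eq (M N : 'M[K]_#|{: I}|) :
  (forall w, dword w *m M = dword w *m N) -> M = N.
Proof.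
by move=> MN; apply/row_matrixP => i; rewrite !rowE -[i]enum_valK; apply: MN.
Qed.

Lemma evl_mulmx m (F : seq nat -> 'rV[K]_#|{: I}|) E (M : 'M[K]_(#|{: I}|, m)) :
  evl F E *m M = evl (fun s => F s *m M) E.
Proof. by rewrite /evl mulmx_suml; apply: eq_bigr => p _; rewrite scalemxAl. Qed.

Lemma tpow_opm g E : perm_sum E -> opm E *m tpow g = tpow g *m opm E.
Proof.
move=> /allP pE; apply: dword_eq => w; rewrite !mulmxA dword_opm evl_mulmx.
rewrite dword_mul mulmx_suml.
under [RHS]eq_bigr do rewrite -scalemxAl dword_opm /evl scaler_sumr.
rewrite exchange_big /evl big_seq [RHS]big_seq; apply: eq_bigr => p /pE ps /=.
under [RHS]eq_bigr do rewrite scalerA mulrC -scalerA.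
rewrite -scaler_sumr; congr (_ *: _); rewrite dword_mul.
rewrite (reindex_inj (act_inj ps)); apply: eq_bigr => w' _; congr (_ *: _).
rewrite !tpowE [RHS](reindex_inj (@seq_perm_inj _ ps)); apply: eq_bigr => k _.
by rewrite !tnth_act.
Qed.

Lemma act_act w s t : all (fun i => i < n)%N t -> size t = n ->
  act (act w s) t = act w (map (nth 0%N s) t).
Proof.
move=> /allP tn szt; apply: eq_from_tnth => k; rewrite !tnth_mktuple.
have kt : (k < size t)%N by rewrite szt.
have jn := tn _ (mem_nth 0%N kt); rewrite (nth_map 0%N) //.
by rewrite -(tnth_nth i0 _ (Ordinal jn)) tnth_mktuple.
Qed.

Definition fcomp (E1 E2 : fsum) : fsum :=
  fbind (fun s => fmap_words (map (nth 0%N s)) E2) E1.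

Lemma perm_word_all s : perm_word s -> all (fun i => i < n)%N s.
Proof. by move=> ps; apply/allP => i; rewrite (perm_mem ps) mem_iota. Qed.

Lemma opm_comp E1 E2 : perm_sum E2 -> opm E1 *m opm E2 = opm (fcomp E1 E2).
Proof.
move=> /allP pE; apply: dword_eq => w; rewrite mulmxA !dword_opm evl_mulmx.
apply/esym/evl_bind => s; rewrite dword_opm evl_fmap; apply: eq_evl_in => p /pE ps /=.
by rewrite act_act ?perm_word_all ?size_perm_word.
Qed.

(** Up to the factor n!, the average of a matrix unit over the simultaneous action of S_n on rows
    and columns. *)
Definition orbit_avg (w w' : I) : 'M[K]_#|{: I}| :=
  \sum_(s <- permutations (iota 0 n))
    delta_mx (enum_rank (act w' s)) (enum_rank (act w s)).

Lemma sum_perms (V : zmodType) (F : seq nat -> V) :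
  \sum_(s <- permutations (iota 0 n)) F s
  = \sum_(f : 'S_n) F [seq val (f k) | k <- enum 'I_n].
Proof.
pose ls (f : 'S_n) := [seq val (f k) | k <- enum 'I_n].
have ls_inj : injective ls.
  move=> f f' /eq_in_map ff'; apply/permP => k; apply: val_inj.
  by apply: ff'; rewrite mem_enum.
have ls_perm f : ls f \in permutations (iota 0 n).
  rewrite mem_permutations uniq_perm ?iota_uniq //.
    rewrite map_inj_uniq ?enum_uniq // => j k /val_inj; exact: perm_inj.
  move=> i; rewrite mem_iota /=; apply/mapP/idP; first by case=> k _ ->; apply: ltn_ord.
  move=> ni; exists (f^-1%g (Ordinal ni)); first by rewrite mem_enum.
  by rewrite permKV.
have uls : uniq (map ls (enum 'S_n)) by rewrite map_inj_uniq ?enum_uniq.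
rewrite [RHS](_ : _ = \sum_(s <- map ls (enum 'S_n)) F s); last first.
  by rewrite big_map big_enum.
have sub : {subset map ls (enum 'S_n) <= permutations (iota 0 n)}.
  by move=> _ /mapP[f _ ->].
have [|_ e] := uniq_min_size uls sub.
  by rewrite size_map -cardE card_Sn size_permutations ?iota_uniq // size_iota.
by apply: perm_big; apply: uniq_perm; rewrite ?permutations_uniq // => s; rewrite e.
Qed.

Definition pick_mx (w w' : I) (S : {set 'I_n}) : 'M[K]_D :=
  \matrix_(a, b) \sum_(m in S) ((a == tnth w m) && (b == tnth w' m))%:R.

(** Polarization: for matrices e_1, ..., e_n, the sum over subsets S of (-1)^(n - |S|) times the
    n-th tensor power of the sum of the e_m, m in S, is the sum over all permutations f of e_f(1) x
    ... x e_f(n). Here e_m is the matrix unit at (w_m, w'_m). *)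
Lemma orbit_avg_tpow w w' :
  orbit_avg w w' =
  \sum_(S : {set 'I_n}) (\prod_i (if i \in S then 1 else -1)) *: tpow (pick_mx w w' S).
Proof.
apply: tuple_matrixP => x y; rewrite /orbit_avg sum_perms !summxE.
under [RHS]eq_bigr do rewrite mxE tpowE.
pose G (f : {ffun 'I_n -> 'I_n}) k : K :=
  ((tnth y k == tnth w (f k)) && (tnth x k == tnth w' (f k)))%:R.
have distr S : \prod_k pick_mx w w' S (tnth y k) (tnth x k)
    = \sum_(f : {ffun 'I_n -> 'I_n}) \prod_k ((f k \in S)%:R * G f k).
  rewrite -(bigA_distr_bigA (fun k m => (m \in S)%:R *
    ((tnth y k == tnth w m) && (tnth x k == tnth w' m))%:R)) /=.
  apply: eq_bigr => k _; rewrite mxE big_mkcond; apply: eq_bigr => m _.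
  by case: (m \in S); rewrite ?mul1r ?mul0r.
under [RHS]eq_bigr do rewrite distr mulr_sumr.
rewrite exchange_big /=.
(* Only the sets S containing the image of f contribute, and their signs cancel unless f is onto,
   that is, injective. *)
have incl_excl (f : {ffun 'I_n -> 'I_n}) :
    \sum_(S : {set 'I_n}) (\prod_i (if i \in S then 1 else -1)) *
      \prod_k ((f k \in S)%:R * G f k)
    = (injectiveb f)%:R * \prod_k G f k.
  pose T := f @: [set: 'I_n].
  transitivity ((\prod_i (1 - (i \notin T)%:R)) * \prod_k G f k); last first.
    congr (_ * _); have [f_inj|f_ninj] := boolP (injectiveb f).
      have /injectiveP/injF_bij[h _ fh] := f_inj.
      by rewrite big1 // => i _; rewrite -[i]fh imset_f ?subr0 ?inE.
    have [i iT] : exists i, i \notin T.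
      apply/existsP; apply: contraR f_ninj => /existsPn Tall.
      have TT : T = [set: 'I_n].
        by apply/setP => i; rewrite inE; apply: negbNE; apply: Tall.
      have /imset_injP f_inj : #|f @: [set: 'I_n]| == #|[set: 'I_n]|.
        by rewrite -/T TT.
      by apply/injectiveP => j k; apply: f_inj; rewrite inE.
    by rewrite (bigD1 i) //= iT subrr mul0r.
  rewrite bigA_distr big_distrl /=; apply: eq_bigr => S _.
  rewrite big_split /= mulrA; congr (_ * _).
  have [/forallP fS|] := boolP [forall k, f k \in S].
    rewrite [X in _ * X]big1 ?mulr1 => [|k _]; last by rewrite fS.
    apply: eq_bigr => i _; case: ifP => // iS.
    suff -> : i \notin T by [].
    by apply: contraFN iS => /imsetP[k _ ->].
  rewrite negb_forall => /existsP[k fkS].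
  rewrite [X in _ * X](bigD1 k) //= (negPf fkS) mul0r mulr0.
  by rewrite (bigD1 (f k)) //= (negPf fkS) imset_f ?inE // oppr0 mul0r.
rewrite [RHS](eq_bigr _ (fun f _ => incl_excl f)).
rewrite [RHS](bigID (fun f : {ffun 'I_n -> 'I_n} => injectiveb f)) /=.
rewrite [X in _ = _ + X]big1 ?addr0 => [|f /negPf->]; last by rewrite mul0r.
rewrite (reindex_onto (fun f : 'S_n => pval f) (insubd (1%g : 'S_n))) => [|f f_inj];
  last by rewrite /= insubdK.
have prodb (b : 'I_n -> bool) : \prod_k (b k)%:R = [forall k, b k]%:R :> K.
  have [/forallP bT|] := boolP [forall k, b k].
    by rewrite big1 // => k _; rewrite bT.
  by rewrite negb_forall => /existsP[k /negPf bk]; rewrite (bigD1 k) //= bk mul0r.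
apply: eq_big => [f|f _]; first by rewrite valKd eqxx andbT; apply/esym/(valP f).
rewrite (_ : injectiveb _ = true) ?mul1r ?prodb; last exact: (valP f).
rewrite mxE !(inj_eq enum_rank_inj); congr (nat_of_bool _)%:R.
have tnth_ls (v : I) k : tnth (act v [seq val (f j) | j <- enum 'I_n]) k = tnth v (f k).
  rewrite tnth_mktuple (nth_map k) ?size_enum_ord // nth_ord_enum.
  by rewrite -(tnth_nth i0).
have pE k : pval f k = f k by rewrite pvalE.
apply/andP/forallP => [[/eqP-> /eqP->] k|e].
  by rewrite pE !tnth_ls !eqxx.
by split; apply/eqP/eq_from_tnth => k; rewrite tnth_ls -pE;
  have /andP[/eqP ? /eqP ?] := e k.
Qed.

End TensorPower.

(** * From invertible to arbitrary matrices *)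

Section Density.
Context {K : fieldType} {D n l : nat}.
Hypothesis charK0 : [pchar K] =i pred0.
Local Notation I := (n.-tuple 'I_D).
Local Notation tpow := (@tpow K D n).
Implicit Types (g : 'M[K]_D) (U : {vspace 'rV[K]_l}).

Lemma poly_eq0_char0 (p : {poly K}) : (forall t, p.[t] = 0) -> p = 0.
Proof.
move=> p0; apply/eqP/contraT => p_neq0.
pose rs : seq K := [seq k%:R | k <- iota 0 (size p)].
have /(max_poly_roots p_neq0) : all (root p) rs by apply/allP => t _; rewrite rootE p0.
rewrite size_map size_iota ltnn => /(_ _)/negP[]; rewrite ?ltnn //.
rewrite map_inj_uniq ?iota_uniq // => i j.
wlog ij : i j / (i <= j)%N => [W|].
  by have [/W|/ltnW/W H /esym/H] := leqP i j.
move=> /esym/eqP; rewrite -subr_eq0 -natrB // natr_char0 // subn_eq0 => ji.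
by apply/eqP; rewrite eqn_leq ij.
Qed.

(** Along the line g + t, the component outside U is polynomial in t and vanishes wherever the
    determinant does not. Its product with the determinant thus vanishes on the infinite field K, so
    the component is the zero polynomial; take t = 0. *)
Lemma vspace_density U (B : 'M[K]_(l, #|{: I}|)) (B' : 'M[K]_(#|{: I}|, l)) x g :
  (forall h, h \in unitmx -> x *m (B *m tpow h *m B') \in U) ->
  x *m (B *m tpow g *m B') \in U.
Proof.
move=> xU.
pose f T := x *m (B *m T *m B') - projv U (x *m (B *m T *m B')).
have fU T : (f T == 0) = (x *m (B *m T *m B') \in U).
  rewrite /f subr_eq0; apply/eqP/idP => [->|/projv_id->//]; exact: memv_proj.
have f_lin : linear f.
  move=> a T T'; rewrite /f !(mulmxDr, mulmxDl) -!(scalemxAr, scalemxAl) linearP /=.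
  by rewrite scalerBr opprD addrACA.
pose fL := GRing.isLinear.Build K _ _ _ f f_lin.
pose F : {linear 'M[K]_#|{: I}| -> 'rV[K]_l} := HB.pack f fL.
have F_sum T : f T = \sum_i \sum_j T i j *: f (delta_mx i j).
  rewrite -[f T]/(F T) {1}[T]matrix_sum_delta linear_sum; apply: eq_bigr => i _.
  by rewrite linear_sum; apply: eq_bigr => j _; rewrite linearZ.
pose G (i j : 'I_#|{: I}|) : {poly K} := \prod_k ((g (tnth (enum_val j : I) k) (tnth (enum_val i : I) k))%:P
   + (tnth (enum_val j : I) k == tnth (enum_val i : I) k)%:R *: 'X).
have GE t (i j : 'I_#|{: I}|) : (G i j).[t] = tpow (g + t%:M) i j.
  rewrite horner_prod mxE; apply: eq_bigr => k _.
  by rewrite !mxE !hornerE mulr_natl.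
pose p c : {poly K} := \sum_i \sum_j f (delta_mx i j) 0 c *: G i j.
have pE c t : (p c).[t] = f (tpow (g + t%:M)) 0 c.
  rewrite F_sum summxE horner_sum; apply: eq_bigr => i _.
  rewrite summxE horner_sum; apply: eq_bigr => j _.
  by rewrite hornerZ GE [RHS]mxE mulrC.
have detE t : (char_poly (- g)).[t] = \det (g + t%:M).
  rewrite -horner_evalE -det_map_mx; congr (\det _); apply/matrixP => i j.
  by rewrite !mxE /= /horner_eval hornerD hornerN hornerMn hornerX hornerC opprK addrC.
have p0 c : p c = 0.
  have : p c * char_poly (- g) = 0.
    apply: poly_eq0_char0 => t; rewrite hornerM detE pE.
    have [/eqP->|d0] := boolP (\det (g + t%:M) == 0); first by rewrite mulr0.
    have : f (tpow (g + t%:M)) == 0 by rewrite fU xU // unitmxE unitfE.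
    by move/eqP->; rewrite mxE mul0r.
  by move/eqP; rewrite mulf_eq0 (negPf (monic_neq0 (char_poly_monic _))) orbF => /eqP.
have g0 : g = g + 0%:M by rewrite raddf0 addr0.
rewrite -fU; apply/eqP/rowP => c; rewrite [RHS]mxE [in LHS]g0 -pE.
by rewrite p0 horner0.
Qed.

End Density.

(** * The simple module of highest weight (3,2,1,1) *)

(* The Young tableau of shape (3,2,1,1) whose rows are the positions 012, 34, *)
(* 5, 6; its columns are 0356, 14, 2.                                         *)
Definition tab_row : seq nat := [:: 0; 0; 0; 1; 1; 2; 3]%N.
Definition tab_col : seq nat := [:: 0; 1; 2; 0; 1; 0; 0]%N.

Definition tab_stab (t : seq nat) : seq (seq nat) :=
  [seq s <- permutations (iota 0 7) | map (nth 0%N t) s == t].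

Definition row_sum : fsum := [seq (Zpos xH, s) | s <- tab_stab tab_row].
Definition col_sum : fsum := [seq (zsign (isort s).1, s) | s <- tab_stab tab_col].

Definition col_word (p q : seq nat) (z : nat) : seq nat :=
  [:: nth 0 p 0; nth 0 q 0; z; nth 0 p 1; nth 0 q 1; nth 0 p 2; nth 0 p 3]%N.

(** Rewriting modulo the column antisymmetrizer: each column is sorted with sign, and a repeated
    letter in a column gives 0. *)
Definition col_sort (t : seq nat) : fsum :=
  let: (e, p) := isort (map (nth 0%N t) [:: 0; 3; 5; 6]%N) in
  let: (f, q) := isort (map (nth 0%N t) [:: 1; 4]%N) in
  if stutter p || stutter q then [::]
  else [:: (zsign (e (+) f), col_word p q (nth 0%N t 2))].

Fixpoint below (l : seq nat) : seq (seq nat) :=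
  if l is a :: l' then [seq b :: t | b <- iota 0 a.+1, t <- below l'] else [:: [::]].

Definition inv_word (s : seq nat) : seq nat := [seq index i s | i <- iota 0 7].

Lemma perm_row_sum : perm_sum (n := 7) row_sum. Proof. by vm_compute. Qed.
Lemma perm_col_sum : perm_sum (n := 7) col_sum. Proof. by vm_compute. Qed.

Lemma row_sum_idem : fnorm (fcomp row_sum row_sum ++ fscale (-12) row_sum) = [::].
Proof. by vm_compute. Qed.

Lemma row_sum_inv :
  fnorm (fmap_words inv_word row_sum ++ fscale (-1) row_sum) = [::].
Proof. by vm_compute. Qed.

Lemma row_sum_invK : all (fun p =>
  [&& map (nth 0%N p.2) (inv_word p.2) == iota 0 7,
      map (nth 0%N (inv_word p.2)) p.2 == iota 0 7 &
      all (fun i => i < 7)%N (inv_word p.2)]) row_sum.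
Proof. by vm_compute. Qed.

(** This is RCRC = 144 RC for the row and column sums R and C, both sides being reduced modulo C.
    The constant 144 = 6 * 3 * 1 * 4 * 1 * 2 * 1 is the product of the hook lengths of (3,2,1,1). *)
Lemma young_idem :
  fnorm (fbind col_sort (fcomp (fcomp row_sum col_sum) row_sum)
         ++ fscale (-144) (fbind col_sort row_sum)) = [::].
Proof. by vm_compute. Qed.

(** The letters 0001123 fill the columns without repetition only as 0123, 01, 0. Hence the vectors
    of highest weight form a line. *)
Lemma col_sort_rearr :
  all (fun s => all (fun p => p.2 == tab_row) (col_sort (map (nth 0%N tab_row) s)))
    (permutations (iota 0 7)).
Proof. by vm_compute. Qed.

(** The words reached from the highest weight word by an upper triangular matrix have letterwise
    smaller or equal letters; all but the word itself vanish after column antisymmetrization. *)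
Lemma col_sort_below :
  all (fun t => (t == tab_row) || (col_sort t == [::])) (below tab_row).
Proof. by vm_compute. Qed.

Lemma col_sum_diag :
  [seq p <- col_sum | map (nth 0%N tab_row) p.2 == tab_row] = [:: (Zpos xH, iota 0 7)].
Proof. by vm_compute. Qed.

Lemma col_sum_swap (c : seq nat) :
  c \in [:: [:: 3; 1; 2; 0; 4; 5; 6]; [:: 0; 1; 2; 5; 4; 3; 6];
            [:: 0; 1; 2; 3; 4; 6; 5]; [:: 0; 4; 2; 3; 1; 5; 6]]%N ->
  fnorm (fcomp [:: (Zpos xH, c)] col_sum ++ col_sum) = [::].
Proof. by rewrite !inE => /or4P[] /eqP->; vm_compute. Qed.

#[local] Opaque row_sum col_sum.

Section Young.
Context {K : fieldType} {D : nat}.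
Hypothesis charK0 : [pchar K] =i pred0.
Hypothesis D_ge4 : (4 <= D)%N.
Variable i0 : 'I_D.
Local Notation I := (7.-tuple 'I_D).
Local Notation act := (@act D 7 i0).
Local Notation dword := (@dword K D 7).
Local Notation opm := (@opm K D 7 i0).

Let rowm := opm row_sum.
Let colm := opm col_sum.
Definition young : 'M[K]_#|{: I}| := rowm *m colm.

Lemma dword_swap u c : c \in [:: [:: 3; 1; 2; 0; 4; 5; 6]; [:: 0; 1; 2; 5; 4; 3; 6];
            [:: 0; 1; 2; 3; 4; 6; 5]; [:: 0; 4; 2; 3; 1; 5; 6]]%N ->
  dword (act u c) *m colm = - (dword u *m colm).
Proof.
move=> cc; have -> : dword (act u c) = dword u *m opm [:: (Zpos xH, c)].
  by rewrite dword_opm evl1 scale1r.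
rewrite -mulmxA opm_comp ?perm_col_sum // !dword_opm; apply/eqP.
by rewrite -addr_eq0 -evl_cat; apply/eqP/evl_norm0/col_sum_swap.
Qed.

Lemma col_word_alt (w : I) q z u a b v : size (u ++ a :: b :: v) = 4%N ->
  dword (act w (col_word (u ++ a :: b :: v) q z)) *m colm
  = - (dword (act w (col_word (u ++ b :: a :: v) q z)) *m colm).
Proof.
case: u => [|c [|d [|e u]]]; case: v => [|f [|g [|h v]]] //=; rewrite ?size_cat ?addnS //= => _.
- by rewrite -(@dword_swap _ [:: 3; 1; 2; 0; 4; 5; 6]%N) ?act_act.
- by rewrite -(@dword_swap _ [:: 0; 1; 2; 5; 4; 3; 6]%N) ?act_act.
- by rewrite -(@dword_swap _ [:: 0; 1; 2; 3; 4; 6; 5]%N) ?act_act.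
Qed.

Lemma col_word_alt2 (w : I) p z u a b v : size (u ++ a :: b :: v) = 2%N ->
  dword (act w (col_word p (u ++ a :: b :: v) z)) *m colm
  = - (dword (act w (col_word p (u ++ b :: a :: v) z)) *m colm).
Proof.
case: u => [|c u]; case: v => [|f v] //=; rewrite ?size_cat ?addnS //= => _.
by rewrite -(@dword_swap _ [:: 0; 4; 2; 3; 1; 5; 6]%N) ?act_act.
Qed.

Lemma evl_col_sort (w : I) t :
  evl (fun s => dword (act w s) *m colm) (col_sort t) = dword (act w t) *m colm.
Proof.
have two0 := two_neq0 charK0.
have tE : act w t = act w (col_word (map (nth 0%N t) [:: 0; 3; 5; 6]%N)
                       (map (nth 0%N t) [:: 1; 4]%N) (nth 0%N t 2)).
  apply: eq_from_tnth => k; rewrite !tnth_mktuple.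
  by case: k => [[|[|[|[|[|[|[|k]]]]]]] lt_k].
rewrite [in RHS]tE /col_sort.
set p := map _ _; set q := map _ [:: 1; 4]%N; set z := nth _ _ _.
have [szp szq] : size p = 4%N /\ size q = 2%N by [].
clearbody p q; clear tE.
pose F p : 'rV[K]_#|{: I}| := dword (act w (col_word p q z)) *m colm.
have /= := @isort_alt _ _ 4 F (@col_word_alt w q z) [::] p szp.
have /= := @stutter_alt _ _ two0 4 F (@col_word_alt w q z) [::] (isort p).2.
rewrite size_isort => /(_ szp); case: (isort p) => e p' /= st_p; rewrite /F => ->.
pose G q : 'rV[K]_#|{: I}| := dword (act w (col_word p' q z)) *m colm.
have /= := @isort_alt _ _ 2 G (@col_word_alt2 w p' z) [::] q szq.
have /= := @stutter_alt _ _ two0 2 G (@col_word_alt2 w p' z) [::] (isort q).2.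
rewrite size_isort => /(_ szq); case: (isort q) => f q' /= st_q E.
case: ifP => [/orP[/st_p st|/st_q st]|_].
- by rewrite evl_nil -/(F p') st scaler0.
- by rewrite evl_nil -/(G q) E st !scaler0.
- by rewrite evl1 /= zr_sign -/(G q) E scalerA signr_addb.
Qed.

End Young.

Section YoungModule.
Context {K : fieldType} {D : nat}.
Hypothesis charK0 : [pchar K] =i pred0.
Hypothesis D_ge4 : (4 <= D)%N.
Variable i0 : 'I_D.
Local Notation I := (7.-tuple 'I_D).
Local Notation act := (@act D 7 i0).
Local Notation dword := (@dword K D 7).
Local Notation opm := (@opm K D 7 i0).
Local Notation tpow := (@tpow K D 7).
Local Notation young := (@young K D i0).
Local Notation oavg := (@orbit_avg K D 7 i0).
Local Notation rowm := (opm row_sum).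
Local Notation colm := (opm col_sum).

Lemma zr_pos_neq0 p : zr (Zpos p) != 0 :> K.
Proof.
rewrite /zr -[int_of_Z _]/(Posz (BinPos.Pos.to_nat p)) -pmulrn natr_char0 //.
by rewrite -lt0n; apply/ssrnat.ltP/Pnat.Pos2Nat.is_pos.
Qed.

Lemma zrN p : zr (Zneg p) = - zr (Zpos p) :> K.
Proof.
apply/eqP; rewrite -addr_eq0 -zrD -[Zneg p]/(Z.opp (Zpos p)).
by rewrite Z.add_opp_diag_l.
Qed.

Lemma fnorm_subr (F : seq nat -> 'rV[K]_#|{: I}|) p E1 E2 :
  fnorm (E1 ++ fscale (Zneg p) E2) = [::] -> evl F E1 = zr (Zpos p) *: evl F E2.
Proof.
move/(evl_norm0 F); rewrite evl_cat evl_scale => /eqP.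
by rewrite zrN scaleNr subr_eq0 => /eqP.
Qed.

Lemma rowm_idem : rowm *m rowm = zr 12 *: rowm.
Proof.
apply: dword_eq => w; rewrite opm_comp ?perm_row_sum // -scalemxAr !dword_opm.
exact: fnorm_subr row_sum_idem.
Qed.

Lemma act_iota (w : I) : act w (iota 0 7) = w.
Proof.
apply: eq_from_tnth => k; rewrite tnth_mktuple nth_iota ?ltn_ord //.
by rewrite -tnth_nth.
Qed.

(** Transposition replaces a place permutation by its inverse, and the row group is closed under
    inverses. *)
Lemma rowm_sym : rowm^T = rowm.
Proof.
have rowE : rowm = opm (fmap_words inv_word row_sum).
  apply: dword_eq => w; rewrite !dword_opm; apply/esym.
  by rewrite (fnorm_subr _ row_sum_inv) scale1r.
apply: tuple_matrixP => x y; rewrite mxE {2}rowE !mxE /evl !summxE [RHS]big_map.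
rewrite big_seq [RHS]big_seq; apply: eq_bigr => p p_row; rewrite !mxE !enum_rankK.
congr (_ * _); rewrite /= !(inj_eq enum_rank_inj) ?eqxx /=; congr (nat_of_bool _)%:R.
have := allP perm_row_sum _ p_row.
have /allP/(_ _ p_row)/and3P[/eqP sK /eqP Ks ltK] := row_sum_invK => ps.
have szK : size (inv_word p.2) = 7%N by rewrite size_map.
apply/eqP/eqP => [->|->]; rewrite act_act ?sK ?Ks ?act_iota //.
  exact: perm_word_all.
exact: size_perm_word.
Qed.

Lemma young_sq : young *m young = zr 144 *: young.
Proof.
have E : young *m young
    = opm (fcomp (fcomp row_sum col_sum) row_sum) *m colm.
  by rewrite -!opm_comp ?perm_row_sum ?perm_col_sum // !mulmxA.
have X w F : evl (fun s => dword (act w s) *m colm) F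
    = evl (fun s => dword (act w s) *m colm) (fbind col_sort F).
  exact/esym/evl_bind/evl_col_sort.
apply: dword_eq => w; rewrite E -scalemxAr /young 2!mulmxA 2!dword_opm 2!evl_mulmx.
rewrite (X w (fcomp _ _)) (X w row_sum).
exact: fnorm_subr young_idem.
Qed.

Definition hw_letters : I := [tuple insubd i0 (val k) | k < 7].
Definition hw_word : I := act hw_letters tab_row.
Definition hw_vec : 'rV[K]_#|{: I}| := dword hw_word *m colm.

Lemma nth_hw_letters j : (j < 7)%N -> nth i0 hw_letters j = insubd i0 j.
Proof. by move=> j7; rewrite -(tnth_nth i0 _ (Ordinal j7)) tnth_mktuple. Qed.

Lemma act_hw_inj s t : size s = 7%N -> size t = 7%N ->
  all (fun i => i < 4)%N s -> all (fun i => i < 4)%N t ->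
  act hw_letters s = act hw_letters t -> s = t.
Proof.
move=> szs szt /allP s4 /allP t4 /(congr1 (fun w : I => tnth w)) st.
apply: (@eq_from_nth _ 0%N); rewrite szs // => j j7.
have := congr1 (fun f => val (f (Ordinal j7))) st; rewrite !tnth_mktuple.
have sj : (nth 0%N s j < 4)%N by apply/s4/mem_nth; rewrite szs.
have tj : (nth 0%N t j < 4)%N by apply/t4/mem_nth; rewrite szt.
rewrite /= !nth_hw_letters ?(leq_trans sj) ?(leq_trans tj) // !val_insubd.
by rewrite (leq_trans sj D_ge4) (leq_trans tj D_ge4).
Qed.

Lemma tab_row_map4 s : size s = 7%N -> size (map (nth 0%N tab_row) s) = 7%N
  /\ all (fun i => i < 4)%N (map (nth 0%N tab_row) s).
Proof.
rewrite size_map; split=> //; apply/allP => _ /mapP[i _ ->].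
by case: i => [|[|[|[|[|[|[|i]]]]]]] //=; rewrite nth_default.
Qed.

Lemma act_hw_word s : perm_word (n := 7) s ->
  (act hw_word s == hw_word) = (map (nth 0%N tab_row) s == tab_row).
Proof.
move=> ps; have szs := size_perm_word ps; have [sz4 lt4] := tab_row_map4 szs.
rewrite /hw_word act_act ?perm_word_all //; apply/eqP/eqP => [|->] //.
by apply: act_hw_inj.
Qed.

Lemma mem_tab_stab t s : s \in tab_stab t ->
  perm_word (n := 7) s /\ map (nth 0%N t) s = t.
Proof. by rewrite mem_filter mem_permutations => /andP[/eqP ? ?]. Qed.

Lemma evl_row_sum (V : lmodType K) (F : seq nat -> V) :
  evl F row_sum = \sum_(s <- tab_stab tab_row) F s.
Proof. by rewrite /evl big_map; apply: eq_bigr => s _; rewrite scale1r. Qed.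

Lemma young_hw : dword hw_word *m young = zr 12 *: hw_vec.
Proof.
rewrite /young mulmxA dword_opm.
have -> : evl (fun s => dword (act hw_word s)) row_sum = zr 12 *: dword hw_word.
  rewrite evl_row_sum big_seq (eq_bigr (fun=> dword hw_word)); last first.
    move=> s /mem_tab_stab[ps ts]; congr dword; apply/eqP.
    by rewrite act_hw_word // ts.
  rewrite -big_seq big_const_seq count_predT.
  have -> : size (tab_stab tab_row) = 12%N by vm_compute.
  by rewrite iter_addr_0 -scaler_nat.
by rewrite -scalemxAl.
Qed.

Definition is_line (u v : 'rV[K]_#|{: I}|) := exists c, u = c *: v.

Lemma is_line_sum (T : eqType) (r : seq T) F v :
  (forall t, t \in r -> is_line (F t) v) -> is_line (\sum_(t <- r) F t) v.
Proof.
elim: r => [|t r IH] Fl; first by exists 0; rewrite big_nil scale0r.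
have [c Ec] := Fl t (mem_head _ _); have [|d Ed] := IH.
  by move=> x xr; apply: Fl; rewrite in_cons xr orbT.
by exists (c + d); rewrite big_cons Ec Ed scalerDl.
Qed.

Lemma young_hw_line s : s \in permutations (iota 0 7) ->
  is_line (dword (act hw_word s) *m young) hw_vec.
Proof.
rewrite mem_permutations => ps; rewrite /young mulmxA dword_opm evl_mulmx evl_row_sum.
apply: is_line_sum => a /mem_tab_stab[pa _].
have [pa7 sza] := (perm_word_all pa, size_perm_word pa).
have [ps7 szs] := (perm_word_all ps, size_perm_word ps).
set sa := map (nth 0%N s) a.
have psa : perm_word (n := 7) sa.
  apply: perm_trans (perm_map _ pa) _.
  by rewrite map_nth_iota0 ?take_oversize ?szs.
have -> : act (act hw_word s) a = act hw_letters (map (nth 0%N tab_row) sa).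
  rewrite act_act // /hw_word act_act //; first exact: perm_word_all.
  exact: size_perm_word.
rewrite -(evl_col_sort charK0); apply: is_line_sum => p p_in.
have sa_in : sa \in permutations (iota 0 7) by rewrite mem_permutations.
have /allP/(_ _ p_in)/eqP -> := allP col_sort_rearr _ sa_in.
by exists (zr p.1).
Qed.

Lemma hw_vec_coord : hw_vec 0 (enum_rank hw_word) = 1.
Proof.
rewrite /hw_vec dword_opm /evl summxE.
rewrite (eq_big_seq (fun p => if map (nth 0%N tab_row) p.2 == tab_row then zr p.1 else 0)).
  by rewrite -big_mkcond -big_filter col_sum_diag big_seq1.
move=> p /(allP perm_col_sum) pp; rewrite !mxE (inj_eq enum_rank_inj) eq_sym.
by rewrite act_hw_word //=; case: eqP; rewrite ?mulr1 ?mulr0.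
Qed.

Lemma young_comm_tpow g : tpow g *m young = young *m tpow g.
Proof.
rewrite /young mulmxA -(tpow_opm i0 g perm_row_sum) -!mulmxA.
by rewrite (tpow_opm i0 g perm_col_sum).
Qed.

Local Notation l := (\rank young).
Let B := row_base young.
Let B' := pinvmx B.

(** T restricted to the image of the symmetrizer, in the coordinates given by the basis B; B' is a
    right inverse of B. *)
Definition red (T : 'M[K]_#|{: I}|) : 'M[K]_l := B *m T *m B'.

Lemma red_mul (y : 'rV[K]_l) T : y *m red T = y *m B *m T *m B'.
Proof. by rewrite /red (mulmxA y (B *m T)) (mulmxA y B). Qed.

Lemma row_in_base (y : 'rV[K]_#|{: I}|) : (y <= young)%MS -> y *m B' *m B = y.
Proof. by move=> yY; apply: mulmxKpV; rewrite eq_row_base. Qed.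

Lemma red_mul_base (y : 'rV[K]_l) T :
  T *m young = young *m T -> y *m red T *m B = y *m B *m T.
Proof.
move=> Tc; rewrite red_mul; apply: row_in_base.
have /submxP[Y ->] : (y *m B <= young)%MS.
  by rewrite (submx_trans (submxMl _ _)) ?eq_row_base.
by rewrite -(mulmxA Y) -Tc (mulmxA Y) submxMl.
Qed.

Lemma base_pinv (x : 'rV[K]_l) : x *m B *m B' = x.
Proof. by rewrite mulmxKp ?row_base_free. Qed.

Lemma base_young (x : 'rV[K]_l) : x *m B *m young = zr 144 *: (x *m B).
Proof.
have /submxP[Y BY] : (B <= young)%MS by rewrite eq_row_base.
by rewrite BY -(mulmxA x) -(mulmxA Y) young_sq -!scalemxAr.
Qed.

Lemma hw_sub : (hw_vec <= young)%MS.
Proof.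
have -> : hw_vec = (zr 12)^-1 *: (dword hw_word *m young).
  by rewrite young_hw scalerA mulVf ?zr_pos_neq0 // scale1r.
by rewrite scalemx_sub ?submxMl.
Qed.

Lemma mul_orbit_avg (u : 'rV[K]_#|{: I}|) w w' :
  u *m oavg w w'
  = \sum_(s <- permutations (iota 0 7)) u 0 (enum_rank (act w' s)) *: dword (act w s).
Proof.
rewrite /orbit_avg mulmx_sumr; apply: eq_bigr => s _.
apply/rowP => j; rewrite !mxE (bigD1 (enum_rank (act w' s))) //= mxE eqxx /=.
by rewrite big1 ?addr0 // => i /negPf ni; rewrite mxE ni mulr0.
Qed.

Lemma orbit_avg_comm w w' :
  oavg w w' *m young = young *m oavg w w'.
Proof.
rewrite orbit_avg_tpow mulmx_suml mulmx_sumr; apply: eq_bigr => S _.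
by rewrite -scalemxAl -scalemxAr young_comm_tpow.
Qed.

Lemma scaled_dword (a : K) (y y' : I) :
  (a *: dword y) 0 (enum_rank y') = a * (y == y')%:R.
Proof. by rewrite !mxE eqxx (inj_eq enum_rank_inj) eq_sym. Qed.

Section Stable.
Variable U : {vspace 'rV[K]_l}.
Hypothesis U_stable : forall g x, g \in unitmx -> x \in U -> x *m red (tpow g) \in U.

(** Polarization writes the average through tensor powers of possibly singular matrices; by density
    these preserve U as well. *)
Lemma stable_orbit_avg w w' x : x \in U -> x *m red (oavg w w') \in U.
Proof.
move=> xU; rewrite orbit_avg_tpow /red mulmx_sumr mulmx_suml mulmx_sumr.
apply: memv_suml => S _; rewrite -scalemxAr -scalemxAl -scalemxAr.
apply: memvZ; apply: (vspace_density charK0) => h h_unit.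
exact: U_stable.
Qed.

(** Write u for x in the tensor power. As u times the symmetrizer is 144 u, u survives row
    symmetrization; pick w' where the result has a nonzero coordinate. The average moving w' to the
    highest weight word sends u to a vector with that same coordinate at [hw_word], and this vector
    is a multiple of [hw_vec] by [young_hw_line]. *)
Lemma stable_hw x : x \in U -> x != 0 -> hw_vec *m B' \in U.
Proof.
move=> xU x0; set u := x *m B.
have u_row : u *m rowm != 0.
  apply: contraNneq x0 => ur0.
  have : u *m young = 0 by rewrite /young mulmxA ur0 mul0mx.
  rewrite base_young => /eqP; rewrite scaler_eq0 (negPf (zr_pos_neq0 _)) /= => /eqP u0.
  by rewrite -[x]base_pinv u0 mul0mx.
have [w' w'0] : exists w' : I, (u *m rowm) 0 (enum_rank w') != 0.
  apply/existsP; apply: contraR u_row; rewrite negb_exists => /forallP u0.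
  by apply/eqP/rowP => j; rewrite -[j]enum_valK [RHS]mxE; apply/eqP/negbNE/u0.
set z := u *m oavg hw_word w'.
have z_hw : z 0 (enum_rank hw_word) = (u *m rowm) 0 (enum_rank w').
  rewrite /z mul_orbit_avg summxE.
  have -> : (u *m rowm) 0 (enum_rank w') = (dword w' *m rowm *m u^T) 0 0.
    have tr1 (M : 'M[K]_1) : M 0 0 = M^T 0 0 by rewrite mxE.
    rewrite [RHS]tr1 (trmx_mul _ u^T) (trmx_mul (dword w')) trmxK rowm_sym [(dword w')^T]trmx_delta mulmxA.
    by rewrite -colE [RHS]mxE.
  rewrite dword_opm evl_mulmx evl_row_sum summxE /tab_stab big_filter.
  rewrite [RHS]big_mkcond big_seq [RHS]big_seq; apply: eq_bigr => s.
  rewrite mem_permutations => ps; rewrite -act_hw_word //.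
  rewrite scaled_dword -rowE [row _ _ 0 0]mxE [u^T _ _]mxE.
  by case: eqP; rewrite ?mulr1 ?mulr0.
have z_young : zr 144 *: z = z *m young.
  have uy : u *m young = zr 144 *: u := base_young x.
  by rewrite /z -(mulmxA u) orbit_avg_comm (mulmxA u) uy scalemxAl.
have [c zc] : is_line (zr 144 *: z) hw_vec.
  rewrite z_young /z mul_orbit_avg mulmx_suml; apply: is_line_sum => s s_perm.
  have [c Ec] := young_hw_line s_perm.
  by exists (u 0 (enum_rank (act w' s)) * c); rewrite -scalemxAl Ec scalerA.
have c0 : c != 0.
  apply: contraNneq w'0 => c0; move: zc; rewrite c0 scale0r => /eqP.
  rewrite scaler_eq0 (negPf (zr_pos_neq0 _)) /= => /eqP z0.
  by rewrite -z_hw z0 mxE.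
have xZ : x *m red (oavg hw_word w') = (zr 144)^-1 * c *: (hw_vec *m B').
  rewrite -scalerA scalemxAl -zc scalemxAl scalerA mulVf ?zr_pos_neq0 // scale1r.
  by rewrite red_mul.
have := stable_orbit_avg hw_word w' xU; rewrite xZ => /(memvZ ((zr 144)^-1 * c)^-1).
rewrite scalerA mulVf ?scale1r //.
by rewrite mulf_neq0 ?invr_eq0 ?zr_pos_neq0.
Qed.

(** The average moving [hw_word] to w commutes with the symmetrizer and sends the highest weight
    vector to the image of w, and these images span the module. *)
Lemma stable_full x : x \in U -> x != 0 -> U = fullv.
Proof.
move=> xU x0; have hwU := stable_hw xU x0.
have genU w : dword w *m young *m B' \in U.
  have := stable_orbit_avg w hw_word hwU; congr (_ \in U).
  rewrite red_mul row_in_base ?hw_sub //; congr (_ *m B').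
  have twelve : zr 12 != 0 :> K := zr_pos_neq0 _.
  apply: (scalerI twelve); rewrite scalemxAl -young_hw -mulmxA -orbit_avg_comm mulmxA.
  have -> : dword hw_word *m oavg w hw_word = dword w *m rowm.
    rewrite mul_orbit_avg dword_opm evl_row_sum /tab_stab big_filter [RHS]big_mkcond.
    rewrite big_seq [RHS]big_seq; apply: eq_bigr => s; rewrite mem_permutations => ps.
    rewrite mxE (inj_eq enum_rank_inj) act_hw_word //=.
    by case: eqP; rewrite ?scale1r ?scale0r.
  by rewrite /young !mulmxA -(mulmxA _ rowm rowm) rowm_idem -scalemxAr -scalemxAl.
apply/vspaceP => y; rewrite memvf -[y]base_pinv.
have /submxP[Y ->] : (y *m B <= young)%MS.
  by rewrite (submx_trans (submxMl _ _)) ?eq_row_base.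
rewrite [Y]row_sum_dword !mulmx_suml; apply: memv_suml => w _.
by rewrite -!scalemxAl; apply: memvZ.
Qed.

End Stable.

Definition young_rho (g : 'M[K]_D) : 'End('rV[K]_l) := linfun (mulmxr (red (tpow g))).

Lemma young_rhoE g x : young_rho g x = x *m red (tpow g).
Proof. by rewrite lfunE. Qed.

Lemma young_rep : GL_rep young_rho.
Proof.
split=> [|g h _ _]; apply/lfunP => x; rewrite young_rhoE.
  by rewrite id_lfunE tpow1 red_mul mulmx1 base_pinv.
rewrite comp_lfunE !young_rhoE (red_mul (x *m _)) red_mul_base ?young_comm_tpow //.
by rewrite red_mul tpowM (mulmxA (x *m B)).
Qed.

Lemma young_simple : (0 < l)%N -> simple_rep young_rho.
Proof.
move=> l_gt0; split.
  by rewrite -dimv_eq0 dimvf /dim /= mul1n -lt0n.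
move=> U U_stable; have [->|/eqP U0] := U =P 0%VS; [by left|right].
have := vpick0 U; rewrite (negPf U0) => /negbT x0.
apply: stable_full (memv_pick U) x0 => g x g_unit xU.
rewrite -young_rhoE; apply: (subvP (U_stable g g_unit)).
exact: memv_img.
Qed.

End YoungModule.

(** * Polynomiality and highest weight of the Young module *)

Section PolynomialFunctions.
Import mpoly.
Context {K : fieldType} {m : nat}.
Implicit Types f h : ('I_m -> K) -> K.

Definition poly_fun f := exists p : mpoly m K, forall x, f x = meval x p.

Lemma poly_fun_ext f h : poly_fun f -> h =1 f -> poly_fun h.
Proof. by case=> p fp hf; exists p => x; rewrite hf. Qed.

Lemma poly_fun_const c : poly_fun (fun=> c).
Proof. by exists (mpolyC m c) => x; rewrite mevalC. Qed.

Lemma poly_fun_var i : poly_fun (fun x => x i).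
Proof. by exists (mpolyX K (mnm1 i)) => x; rewrite mevalXU. Qed.

Lemma poly_fun_add f h : poly_fun f -> poly_fun h -> poly_fun (fun x => f x + h x).
Proof. by move=> [p fp] [q hq]; exists (p + q) => x; rewrite mevalD fp hq. Qed.

Lemma poly_fun_mul f h : poly_fun f -> poly_fun h -> poly_fun (fun x => f x * h x).
Proof. by move=> [p fp] [q hq]; exists (p * q) => x; rewrite mevalM fp hq. Qed.

Lemma poly_fun_sum (T : finType) (F : T -> ('I_m -> K) -> K) :
  (forall t, poly_fun (F t)) -> poly_fun (fun x => \sum_t F t x).
Proof.
move=> PF; elim: (index_enum T) => [|t r IH].
  by apply: poly_fun_ext (poly_fun_const 0) _ => x; rewrite big_nil.
by apply: poly_fun_ext (poly_fun_add (PF t) IH) _ => x; rewrite big_cons.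
Qed.

Lemma poly_fun_prod (T : finType) (F : T -> ('I_m -> K) -> K) :
  (forall t, poly_fun (F t)) -> poly_fun (fun x => \prod_t F t x).
Proof.
move=> PF; elim: (index_enum T) => [|t r IH].
  by apply: poly_fun_ext (poly_fun_const 1) _ => x; rewrite big_nil.
by apply: poly_fun_ext (poly_fun_mul (PF t) IH) _ => x; rewrite big_cons.
Qed.

End PolynomialFunctions.

Section YoungHighestWeight.
Context {K : fieldType} {D : nat}.
Hypothesis charK0 : [pchar K] =i pred0.
Hypothesis D_ge4 : (4 <= D)%N.
Variable i0 : 'I_D.
Local Notation I := (7.-tuple 'I_D).
Local Notation act := (@act D 7 i0).
Local Notation tpow := (@tpow K D 7).
Local Notation young := (@young K D i0).
Local Notation l := (\rank young).
Local Notation B := (row_base young).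
Local Notation B' := (pinvmx B).
Local Notation red := (@red K D i0).
Local Notation young_rho := (@young_rho K D i0).
Local Notation hw_vec := (@hw_vec K D i0).
Local Notation hw_word := (@hw_word D i0).
Local Notation hw_letters := (@hw_letters D i0).

Lemma young_polynomial : polynomial_rep young_rho.
Proof.
move=> phi v.
pose f (T : 'M[K]_#|{: I}|) := phi (v *m red T).
have phiZ a y : phi (a *: y) = a * phi y by exact: linearZ.
have fE T : f T = \sum_i \sum_j f (delta_mx i j) * T i j.
  rewrite {1}/f red_mul {1}[T]matrix_sum_delta mulmx_sumr mulmx_suml linear_sum.
  apply: eq_bigr => i _; rewrite mulmx_sumr mulmx_suml linear_sum.
  apply: eq_bigr => j _ /=; rewrite /f red_mul.
  by rewrite -scalemxAr -scalemxAl phiZ mulrC.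
have [p fp] : poly_fun (fun x : 'I_(D * D) -> K => f (tpow (vec_mx (\row_k x k)))).
  apply: (@poly_fun_ext _ _ (fun x => \sum_i \sum_j f (delta_mx i j) *
    \prod_k x (mxvec_index (tnth (enum_val j : I) k) (tnth (enum_val i : I) k)))).
    apply: poly_fun_sum => i; apply: poly_fun_sum => j; apply: poly_fun_mul.
      exact: poly_fun_const.
    by apply: poly_fun_prod => k; apply: poly_fun_var.
  move=> x; rewrite fE; apply: eq_bigr => i _; apply: eq_bigr => j _; congr (_ * _).
  rewrite mxE; apply: eq_bigr => k _.
  by rewrite -[LHS]mxvecE vec_mxK mxE.
exists p => g _; rewrite young_rhoE -/(f _) -fp; congr (f (tpow _)).
by rewrite -[LHS]mxvecK; congr vec_mx; apply/rowP => k; rewrite mxE.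
Qed.

Lemma mem_below t s : size t = size s ->
  (forall k, (k < size s)%N -> (nth 0 t k <= nth 0 s k)%N) -> t \in below s.
Proof.
elim: s t => [|b s IH] [|a t] // [szt] ts.
apply/allpairsPdep; exists a, t; rewrite mem_iota ltnS (ts 0%N) //; split=> //.
by apply: IH => // k; apply: (ts k.+1).
Qed.

Lemma val_hw_word k : tnth hw_word k = nth 0%N tab_row k :> nat.
Proof.
have j4 : (nth 0%N tab_row k < 4)%N by case: k => [[|[|[|[|[|[|[|k]]]]]]] ?].
rewrite tnth_mktuple nth_hw_letters; last exact: leq_trans j4 _.
by rewrite val_insubd (leq_trans j4 D_ge4).
Qed.

Lemma hw_vec_upper (b : 'M[K]_D) : is_trig_mx b^T ->
  hw_vec *m tpow b = (\prod_k b (tnth hw_word k) (tnth hw_word k)) *: hw_vec.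
Proof.
move=> /is_trig_mxP b_up.
rewrite -mulmxA (tpow_opm i0 b perm_col_sum) mulmxA dword_mul mulmx_suml.
rewrite (bigD1 hw_word) //= tpowE -scalemxAl [X in _ + X]big1 ?addr0 // => w w_hw.
rewrite -scalemxAl tpowE.
(* A word with some letter above that of [hw_word] has coefficient 0, because b is upper
   triangular. *)
have [le_hw|] := boolP [forall k, tnth w k <= tnth hw_word k]%N; last first.
  rewrite negb_forall => /existsP[k]; rewrite -ltnNge => lt_k.
  by rewrite (bigD1 k) //=; have := b_up _ _ lt_k; rewrite mxE => ->; rewrite !mul0r scale0r.
pose t := [seq val i | i <- w].
have t_le k : (k < 7)%N -> (nth 0 t k <= nth 0 tab_row k)%N.
  move=> k7; have /forallP/(_ (Ordinal k7)) := le_hw.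
  by rewrite val_hw_word (nth_map i0) ?size_tuple // (tnth_nth i0).
have wt : w = act hw_letters t.
  apply: eq_from_tnth => k; have tk4 : (nth 0 t k < 4)%N.
    apply: leq_ltn_trans (t_le k (ltn_ord k)) _.
    by case: k => [[|[|[|[|[|[|[|k]]]]]]] ?].
  rewrite tnth_mktuple nth_hw_letters; last exact: leq_trans tk4 _.
  apply: val_inj; rewrite val_insubd (leq_trans tk4 D_ge4).
  by rewrite (nth_map i0) ?size_tuple // (tnth_nth i0).
have t_below : t \in below tab_row.
  by apply: mem_below; rewrite ?size_map ?size_tuple.
have /orP[/eqP ts|/eqP ts] := allP col_sort_below _ t_below.
  by case/eqP: w_hw; rewrite wt ts.
by rewrite wt -(evl_col_sort charK0) ts evl_nil scaler0.
Qed.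

Lemma prod_hw_word (F : 'I_D -> K) :
  \prod_k F (tnth hw_word k) = \prod_(i < D) F i ^+ nth 0%N [:: 3; 2; 1; 1]%N i.
Proof.
rewrite (partition_big (tnth hw_word) predT) //=; apply: eq_bigr => i _.
rewrite (eq_bigr (fun=> F i)) => [|k /eqP-> //]; rewrite prodr_const; congr (_ ^+ _).
rewrite (eq_card (B := [pred k : 'I_7 | nth 0%N tab_row k == i])); last first.
  by move=> k; rewrite [RHS]inE -(val_hw_word k).
rewrite -sum1_card big_mkcond !big_ord_recl big_ord0 !inE /=.
by case: i => [[|[|[|[|i]]]] lti] //=; rewrite nth_nil.
Qed.

Lemma hw_coord_neq0 : hw_vec *m B' != 0.
Proof.
apply: contraTneq isT => h0; have := row_in_base (hw_sub charK0 D_ge4 i0).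
rewrite h0 mul0mx => /rowP/(_ (enum_rank hw_word)); rewrite hw_vec_coord // mxE => /eqP.
by rewrite eq_sym oner_eq0.
Qed.

Lemma young_highest_weight : has_highest_weight young_rho [:: 3; 2; 1; 1]%N.
Proof.
exists (hw_vec *m B'); first exact: hw_coord_neq0.
move=> b _ b_up; rewrite young_rhoE red_mul row_in_base ?hw_sub //.
by rewrite hw_vec_upper // -scalemxAl (prod_hw_word (fun i => b i i)).
Qed.

Lemma dim_young : dim_simple_GL K D [:: 3; 2; 1; 1]%N l.
Proof.
rewrite /dim_simple_GL D_ge4; exists 'rV[K]_l, young_rho.
have l_gt0 : (0 < l)%N.
  rewrite lt0n mxrank_eq0; apply: contraTneq isT => y0.
  have := hw_sub charK0 D_ge4 i0; rewrite y0 submx0 => /eqP h0.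
  by have := @hw_vec_coord K D D_ge4 i0; rewrite h0 mxE => /eqP; rewrite eq_sym oner_eq0.
split; first exact: young_rep.
- exact: young_polynomial.
- exact: young_simple.
- exact: young_highest_weight.
by rewrite dimvf /dim /= mul1n.
Qed.

Lemma rank_young : zr 144 * l%:R = \tr young.
Proof.
have z144 := zr_pos_neq0 charK0 144.
have P_idem : ((zr 144)^-1 *: young) *m ((zr 144)^-1 *: young) = (zr 144)^-1 *: young.
  by rewrite -scalemxAl -scalemxAr (young_sq charK0) !scalerA -mulrA mulVf // mulr1.
have := rank_idempotent P_idem; rewrite mxrank_scale_nz ?invr_eq0 // => ->.
by rewrite mxtraceZ mulrA mulfV // mul1r.
Qed.

End YoungHighestWeight.

(** * Dimensions *)

Lemma trace4 : trace_ok 4 (fbind full (quo rel4))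
  && (trace_poly (fbind full (quo rel4)) == [:: 0; -6; 11; -6; 1])%BZ.
Proof. by vm_compute. Qed.

Lemma trace5 : trace_ok 5 (fbind full (quo rel5))
  && (trace_poly (fbind full (quo rel5)) == [:: 0; 0; -12; 22; -12; 2])%BZ.
Proof. by vm_compute. Qed.

Lemma trace6 : trace_ok 6 (fbind full (quo rel6))
  && (trace_poly (fbind full (quo rel6)) == [:: 0; 0; -96; 80; 80; -80; 16])%BZ.
Proof. by vm_compute. Qed.

Lemma trace7 : trace_ok 7 (fbind full (quo rel7))
  && (trace_poly (fbind full (quo rel7))
      == [:: 0; 0; 589824; -1966080; 737280; 1720320; -1327104; 245760])%BZ.
Proof. by vm_compute. Qed.

(** The polynomial is D^2 (D^2 - 1) (D^2 - 4) (D - 3), the product of the D + c over the contents c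
    of (3,2,1,1), as in the hook content formula. *)
Lemma trace_young : trace_ok 7 (fcomp row_sum col_sum)
  && (trace_poly (fcomp row_sum col_sum) == [:: 0; 0; -12; 4; 15; -5; -3; 1])%BZ.
Proof. by vm_compute. Qed.

#[local] Opaque rel4 rel5 rel6 rel7 row_sum col_sum.

Definition zpoly (l : seq Z) (x : Z) : Z :=
  foldr (fun c y => Z.add c (Z.mul x y)) Z0 l.

Section Dimensions.
Context {K : fieldType} {D : nat}.
Hypothesis charK0 : [pchar K] =i pred0.
Variable i0 : 'I_D.

Lemma zr_inj : injective (zr : Z -> K).
Proof.
move=> a b ab; apply/Z.sub_move_0_r.
have : zr (Z.add a (Z.opp b)) = 0 :> K.
  by rewrite zrD ab -zrD Z.add_opp_diag_r.
rewrite -/(Z.sub a b); case: (Z.sub a b) => // p.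
  by move/eqP; rewrite (negPf (zr_pos_neq0 charK0 _)).
by move/eqP; rewrite zrN oppr_eq0 (negPf (zr_pos_neq0 charK0 _)).
Qed.

Lemma zr_of_nat d : zr (Z.of_nat d) = d%:R :> K.
Proof. by elim: d => // d IH; rewrite Nat2Z.inj_succ -Z.add_1_r zrD IH -natr1. Qed.

Lemma zr_poly l d :
  \sum_(k < size l) zr (nth Z0 l k) * d%:R ^+ k = zr (zpoly l (Z.of_nat d)) :> K.
Proof.
elim: l => [|c l IH] /=; first by rewrite big_ord0.
rewrite big_ord_recl mulr1 zrD zrM -IH zr_of_nat mulr_sumr; congr (_ + _).
by apply: eq_bigr => k _; rewrite exprS mulrCA.
Qed.

(** The factor 2N, which appears as [xO N], clears the denominator of the idempotent, so that its
    trace identity becomes one between integers. *)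
Lemma missing_dim n N r tp : (0 < n)%N -> splits n (Zpos N) r ->
  trace_ok n (fbind full (quo r)) && (trace_poly (fbind full (quo r)) == tp) ->
  in_SJ (K := K) r ->
  exists d, dim_missing_tetrads K D n d /\
    Z.mul (Zpos (xO N)) (Z.of_nat d) = zpoly tp (Z.of_nat D).
Proof.
move=> n_gt0 /and5P[q_deg q_core /eqP q_lett /eqP q_sym /andP[/allP q_kill /eqP q_rel]].
move=> /andP[tr_ok /eqP tr_poly] r_SJ.
have N_neq0 := zr_pos_neq0 charK0 N.
have kill c : opdeg c = n ->
    fnf (fbind (fun s => frelab s (quo r)) (full (opword c (iota 0 n)))) = [::].
  by move=> cn; apply/eqP/q_kill; rewrite -cn mem_opcodes.
have rel : in_SJ (K := K) (fscale (Zpos N) (pal (iota 0 n)) ++ fscale (Zneg xH) (quo r)).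
  by move=> D' x Sx; rewrite (fnorm_sub _ q_rel); apply: r_SJ.
exists (\rank (@projmx K D n i0 (quo r) (Zpos N))); split.
  exact: dim_quot_proj.
apply: zr_inj; rewrite zrM zr_of_nat -tr_poly -zr_poly -(trace_opm i0 tr_ok).
rewrite rank_idempotent; last exact: proj_idem.
have -> : zr (Zpos (xO N)) = 2%:R * zr (Zpos N) :> K.
  by rewrite -[2%:R]/(zr (Zpos (xO xH))) -zrM.
by rewrite mxtraceZ mulrA mulfV ?mul1r // mulf_neq0 ?two_neq0.
Qed.

Lemma young_dim : (4 <= D)%N -> exists l, dim_simple_GL K D [:: 3; 2; 1; 1]%N l /\
  Z.mul 144 (Z.of_nat l)
  = zpoly [:: 0; 0; -12; 4; 15; -5; -3; 1]%BZ (Z.of_nat D).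
Proof.
move=> D_ge4; exists (\rank (@young K D i0)); split; first exact: dim_young.
have /andP[tr_ok /eqP tr_poly] := trace_young.
apply: zr_inj; rewrite -tr_poly -zr_poly -(trace_opm i0 tr_ok).
by rewrite -(opm_comp _ _ perm_col_sum) zrM zr_of_nat (rank_young charK0 i0).
Qed.

End Dimensions.

Lemma bin4Z D : let x := Z.of_nat D in
  (24 * Z.of_nat 'C(D, 4) = x * (x - 1) * (x - 2) * (x - 3))%BZ.
Proof.
move=> x; have : ('C(D, 4) * 4`! = D ^_ 4)%N := bin_ffact D 4.
rewrite /x {x}; case: D => [|[|[|[|d]]]] //; rewrite !ffactSS ffactn0.
rewrite -[4`!]/24%N; lia.
Qed.

Lemma bin2Z D : let x := Z.of_nat D in (2 * Z.of_nat 'C(D.+1, 2) = x * (x + 1))%BZ.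
Proof.
move=> x; have : ('C(D.+1, 2) * 2`! = D.+1 ^_ 2)%N := bin_ffact D.+1 2.
rewrite /x {x}; case: D => [|d] //; rewrite !ffactSS ffactn0.
rewrite -[2`!]/2%N; lia.
Qed.

Section BinomialPolynomials.
Variable D : nat.
Let x := Z.of_nat D.
Let c := Z.of_nat 'C(D, 4).
Let t := Z.of_nat 'C(D.+1, 2).

Lemma dim4_zpoly d : Z.mul 24 (Z.of_nat d) = zpoly [:: 0; -6; 11; -6; 1]%BZ x ->
  d = 'C(D, 4).
Proof.
move=> E; apply: Nat2Z.inj; move: E (bin4Z D); cbn [zpoly foldr]; rewrite -/x -/c.
move: (Z.of_nat d) (c) (x) => *. lia.
Qed.

Lemma dim5_zpoly d : Z.mul 48 (Z.of_nat d) = zpoly [:: 0; 0; -12; 22; -12; 2]%BZ x ->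
  d = (D * 'C(D, 4))%N.
Proof.
move=> E; apply: Nat2Z.inj; rewrite Nat2Z.inj_mul.
move: E (congr1 (Z.mul x) (bin4Z D)); cbn [zpoly foldr]; rewrite -/x -/c.
move: (Z.of_nat d) (c) (x) => *; lia.
Qed.

Lemma bin_zpoly : (48 * (t * c)
  = (x * (x + 1)) * (x * (x - 1) * (x - 2) * (x - 3)))%BZ.
Proof.
have E2 : (2 * t = x * (x + 1))%BZ by apply: bin2Z.
have E4 : (24 * c = x * (x - 1) * (x - 2) * (x - 3))%BZ by apply: bin4Z.
by rewrite -E2 -E4; move: (t) (c) => *; lia.
Qed.

Lemma dim6_zpoly d :
  Z.mul 384 (Z.of_nat d) = zpoly [:: 0; 0; -96; 80; 80; -80; 16]%BZ x ->
  d = (2 * 'C(D.+1, 2) * 'C(D, 4))%N.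
Proof.
move=> E; apply: Nat2Z.inj; rewrite !Nat2Z.inj_mul -/t -/c.
move: E bin_zpoly; cbn [zpoly foldr].
move: (Z.of_nat d) (c) (t) (x) => *; lia.
Qed.

Lemma dim7_zpoly d :
  Z.mul 7077888 (Z.of_nat d)
    = zpoly [:: 0; 0; 589824; -1966080; 737280; 1720320; -1327104; 245760]%BZ x ->
  Z.mul 144 (Z.sub (Z.of_nat (2 * D * 'C(D.+1, 2) * 'C(D, 4))) (Z.of_nat d))
    = zpoly [:: 0; 0; -12; 4; 15; -5; -3; 1]%BZ x.
Proof.
rewrite !Nat2Z.inj_mul -/t -/c -/x.
move=> E; move: E (congr1 (Z.mul x) bin_zpoly); cbn [zpoly foldr].
move: (Z.of_nat d) (c) (t) (x) => *; lia.
Qed.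

End BinomialPolynomials.

Theorem lemma4 (K : fieldType) (charK0 : [pchar K] =i pred0)
    (D : nat) (D_ge1 : (1 <= D)%N) :
  [/\ dim_missing_tetrads K D 4 'C(D, 4),
      dim_missing_tetrads K D 5 (D * 'C(D, 4))%N,
      dim_missing_tetrads K D 6 (2 * 'C(D.+1, 2) * 'C(D, 4))%N &
      exists d7 l : nat,
        [/\ dim_missing_tetrads K D 7 d7,
            dim_simple_GL K D [:: 3; 2; 1; 1]%N l &
            d7%:Z = (2 * D * 'C(D.+1, 2) * 'C(D, 4))%:Z - l%:Z]].
Proof.
pose i0 : 'I_D := Ordinal D_ge1.
have [d4 [M4 /dim4_zpoly E4]] :=
  missing_dim (n := 4) charK0 i0 isT splits4 trace4 (in_SJ_rel4 charK0).
have [d5 [M5 /dim5_zpoly E5]] := missing_dim (n := 5) charK0 i0 isT splits5 trace5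
  (in_SJ_rotrel charK0 5 (in_SJ_rel4 charK0)).
have [d6 [M6 /dim6_zpoly E6]] :=
  missing_dim (n := 6) charK0 i0 isT splits6 trace6 (in_SJ_rel6 charK0).
have [d7 [M7 /dim7_zpoly E7]] :=
  missing_dim (n := 7) charK0 i0 isT splits7 trace7 (in_SJ_rel7 charK0).
split; rewrite -?E5 -?E6 -?E4 //; exists d7; rewrite E4.
have [D_ge4|D_lt4] := leqP 4 D.
  have [l [Ll El]] := young_dim charK0 i0 D_ge4; exists l; split=> //.
  move: E7; rewrite -El; move: (2 * D * _ * _)%N => b E.
  have -> : b = (d7 + l)%N by lia.
  by rewrite PoszD addrK.
(* For D < 4 the module is 0 by convention and the binomial coefficient vanishes; D = 1, 2, 3 are
   roots of the polynomial, hence M_7 is 0. *)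
exists 0%N; split=> //; first by rewrite /dim_simple_GL leqNgt D_lt4.
move: E7; rewrite (bin_small D_lt4) muln0 subr0 => E7.
suff -> : d7 = 0%N by [].
by move: E7; case: (D) D_lt4 => [|[|[|[|]]]] // _; cbn [zpoly foldr]; lia.
Qed.
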